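(* For every integer $n\geq 1$ there exists an irreducible complex projective variety $X$ of dimension $n$ which admits a $\mathbb{C}^*$-action with isolated fixed points and whose first Betti number $\beta_1(X)=\operatorname{rank} H_1(X,\mathbb{Z})$ is nonzero.
   Context: The variety is allowed to be singular and the $\mathbb{C}^*$-action is algebraic. ''Isolated fixed points'' means that the fixed point set $X^{\mathbb{C}^*}$ is finite. $H_1(X,\mathbb{Z})$ is singular homology for the complex topology. *)

(* Defs.v *)
From HB Require Import structures.
(* [mpoly] shadows names such as [symmetric], so it comes first, and its
   notations are incompatible with those of the analysis library. *)
From mathcomp Require Import -(notations) freeg mpoly.
From mathcomp Require Import all_boot all_order all_algebra.
From mathcomp Require Import all_classical all_reals all_analysis.
From mathcomp Require Import complex.

Set Implicit Arguments.
Unset Strict Implicit.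
Unset Printing Implicit Defensive.

Import Order.TTheory GRing.Theory Num.Theory.
Import numFieldNormedType.Exports.

Local Open Scope classical_set_scope.
Local Open Scope quotient_scope.
Local Open Scope ring_scope.

Section ProjectiveSpace.
Context (K : numFieldType) (N : nat).

Definition nonzero_vec := set_type [set v : 'rV[K]_N.+1 | v != 0].
HB.instance Definition _ := Topological.on nonzero_vec.
HB.instance Definition _ := Choice.on nonzero_vec.

Definition proportional (u v : nonzero_vec) : bool :=
  `[< exists2 c : K, c != 0 & set_val u = c *: set_val v >].

Lemma proportional_refl : reflexive proportional.
Proof. by move=> u; apply/asboolP; exists 1; rewrite ?oner_neq0 ?scale1r. Qed.

Lemma proportional_sym : symmetric proportional.
Proof.
suff sub u v : proportional u v -> proportional v u.
  by move=> u v; apply/idP/idP; exact: sub.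
move=> /asboolP[c c0 uv]; apply/asboolP; exists c^-1; first by rewrite invr_eq0.
by rewrite uv scalerA mulVf// scale1r.
Qed.

Lemma proportional_trans : transitive proportional.
Proof.
move=> v u w /asboolP[c c0 uv] /asboolP[d d0 vw]; apply/asboolP.
by exists (c * d); rewrite ?mulf_neq0// uv vw scalerA.
Qed.

Canonical proportional_equiv :=
  EquivRel proportional
    proportional_refl proportional_sym proportional_trans.
Canonical proportional_encModRel := defaultEncModRel proportional.

(* The topology carried by this type is the quotient of the usual topology of
   K^(N+1) \ {0}: for K = C, the complex topology. The Zariski topology is given
   separately by [zariski_closed]. *)
Definition projspace := quotient_topology {eq_quot proportional}.
HB.instance Definition _ := Topological.on projspace.
HB.instance Definition _ := Choice.on projspace.

Definition homogeneous_coords (x : projspace) (v : 'rV[K]_N.+1) : Prop :=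
  exists2 u : nonzero_vec, \pi_projspace u = x & set_val u = v.

End ProjectiveSpace.

Definition homogeneous_of_degree (A : nzRingType) (m d : nat) (f : mpoly m A) :=
  f \is ishomog1 d mdeg.

Section Zariski.
Context (K : numFieldType) (N : nat).
Local Notation P := (projspace K N).

Definition eval (f : mpoly N.+1 K) (v : 'rV[K]_N.+1) : K :=
  meval (fun i => v 0 i) f.

Definition zariski_closed (A : set P) : Prop :=
  exists2 S : set (mpoly N.+1 K),
    forall f, S f -> exists d, homogeneous_of_degree d f &
    A = [set x | forall f v, S f -> homogeneous_coords x v -> eval f v = 0].

Definition zariski_irreducible (X : set P) : Prop :=
  X !=set0 /\
  forall A B : set P, zariski_closed A -> zariski_closed B ->
    X `<=` A `|` B -> X `<=` A \/ X `<=` B.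

Definition projective_variety (X : set P) : Prop :=
  zariski_closed X /\ zariski_irreducible X.

Definition irreducible_chain (X : set P) (m : nat) (Z : nat -> set P) : Prop :=
  (forall i, (i <= m)%N -> projective_variety (Z i) /\ Z i `<=` X) /\
  (forall i, (i < m)%N -> Z i `<` Z i.+1).

(* Krull dimension *)
Definition has_dimension (X : set P) (n : nat) : Prop :=
  (exists Z, irreducible_chain X n Z) /\
  (forall m Z, irreducible_chain X m Z -> (m <= n)%N).

End Zariski.

Section MultiplicativeGroupActions.
Context (K : numFieldType) (N : nat).
Local Notation P := (projspace K N).

(* A polynomial in t, x_0, ..., x_N, seen as a polynomial in the x_i with
   coefficients in K[t]; being homogeneous then refers to the x_i only. *)
Definition eval2 (f : mpoly N.+1 {poly K}) (t : K) (v : 'rV[K]_N.+1) : K :=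
  eval (map_mpoly (horner_eval t) f) v.

(* Zariski open subsets of A^1 x P^N. *)
Definition zariski_open2 (U : set (K * P)) : Prop :=
  exists2 S : set (mpoly N.+1 {poly K}),
    forall f, S f -> exists d, homogeneous_of_degree d f &
    ~` U = [set tx | forall f v,
              S f -> homogeneous_coords tx.2 v -> eval2 f tx.1 v = 0].

(* a is a morphism of varieties from K^* x X to P^N: around every point it is
   given by N+1 polynomials of the same degree in the x_i, without common zero.
   Negative powers of t are not needed, as they can be cleared from all the N+1
   components at once. *)
Definition regular_on (X : set P) (a : K -> P -> P) : Prop :=
  forall t0 x0, t0 != 0 -> X x0 ->
  exists U : set (K * P), [/\ zariski_open2 U, U (t0, x0) &
    exists d (F : 'I_N.+1 -> mpoly N.+1 {poly K}),
      (forall i, homogeneous_of_degree d (F i)) /\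
      forall t x v, t != 0 -> X x -> U (t, x) -> homogeneous_coords x v ->
        homogeneous_coords (a t x) (\row_i eval2 (F i) t v)].

(* The values of a outside K^* x X are irrelevant. *)
Definition algebraic_action (X : set P) (a : K -> P -> P) : Prop :=
  [/\ forall t x, t != 0 -> X x -> X (a t x),
      forall x, X x -> a 1 x = x,
      forall s t x, s != 0 -> t != 0 -> X x -> a (s * t) x = a s (a t x) &
      regular_on X a].

Definition fixed_points (X : set P) (a : K -> P -> P) : set P :=
  [set x | X x /\ forall t, t != 0 -> a t x = x].

End MultiplicativeGroupActions.

Section StandardSimplex.
Context (R : realType).

Definition simplex_set (k : nat) : set 'rV[R]_k.+1 :=
  [set v | (forall i, 0 <= v 0 i) /\ \sum_i v 0 i = 1].

Definition std_simplex (k : nat) := set_type (@simplex_set k).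
HB.instance Definition _ k := Topological.on (std_simplex k).
HB.instance Definition _ k := Choice.on (std_simplex k).

(* Inserts the coordinate 0 at position i. *)
Definition insert0 (k : nat) (i : 'I_k.+2) (v : 'rV[R]_k.+1) : 'rV[R]_k.+2 :=
  \row_j (if unlift i j is Some j' then v 0 j' else 0).

Lemma insert0_simplex k i v :
  simplex_set v -> simplex_set (insert0 (k := k) i v).
Proof.
move=> [v0 v1]; split=> [j|].
  by rewrite mxE; case: unliftP => // j' _; exact: v0.
rewrite (bigD1_ord i)//= mxE unlift_none add0r -v1; apply: eq_bigr => j _.
by rewrite mxE liftK.
Qed.

Lemma insert0_continuous k i : continuous (@insert0 k i).
Proof.
move=> v A [P vP PA]; exists (fun _ j => P 0 (lift i j)).
  by move=> a j; rewrite ord1; have := vP 0 (lift i j); rewrite mxE liftK.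
move=> w wP; apply: PA => a j; rewrite ord1 mxE.
case: unliftP => [j' ->|->]; first exact: wP.
by have /nbhs_singleton := vP 0 i; rewrite mxE unlift_none.
Qed.

Definition face (k : nat) (i : 'I_k.+2) (v : std_simplex k) :
    std_simplex k.+1 :=
  SigSub (mem_set (insert0_simplex i (set_mem (valP v)))).

Lemma face_continuous k i : continuous (@face k i).
Proof.
apply/continuousP => _ [B oB <-].
suff -> : face i @^-1` (set_val @^-1` B) = set_val @^-1` (insert0 i @^-1` B).
  exists (insert0 i @^-1` B) => //.
  by move/continuousP: (@insert0_continuous k i); exact.
by [].
Qed.

HB.instance Definition _ k i := isContinuous.Build _ _ _ (@face_continuous k i).

End StandardSimplex.

Section SingularHomology.
Context (R : realType) (X : topologicalType).

Definition singular_simplex (k : nat) := continuousType (std_simplex R k) X.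
HB.instance Definition _ k := Choice.on (singular_simplex k).

(* The free abelian group on the singular k-simplices. *)
Definition chain (k : nat) :=
  FreegDefs.type_of (Phant int) (Phant (singular_simplex k)).
HB.instance Definition _ k := GRing.Lmodule.on (chain k).

Definition simplex_face k (s : singular_simplex k.+1) (i : 'I_k.+2) :
  singular_simplex k := s \o face i.

Definition simplex_boundary k (s : singular_simplex k.+1) : chain k :=
  \sum_(i < k.+2) (-1) ^+ i *: Freeg [:: (1, simplex_face s i)].

Definition boundary k : chain k.+1 -> chain k :=
  fglift (@simplex_boundary k).

Lemma boundary_additive k : additive (@boundary k).
Proof. exact: lift_is_additive. Qed.

Definition is_cycle k : {pred chain k} :=
  match k with
  | 0 => fun _ => true
  | k'.+1 => fun c => boundary c == 0
  end.

Lemma is_cycle_zmod_closed k : zmod_closed (is_cycle (k := k)).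
Proof.
case: k => [//|k]; have bB := @boundary_additive k; split.
  by rewrite /in_mem/= -[0]subr0 bB subrr.
by move=> x y /eqP x0 /eqP y0; rewrite /in_mem/= bB x0 y0 subrr.
Qed.

HB.instance Definition _ k :=
  GRing.isZmodClosed.Build (chain k) (is_cycle (k := k))
    (is_cycle_zmod_closed k).

Definition cycle (k : nat) : Type := {c : chain k | is_cycle c}.
HB.instance Definition _ k := [isSub of cycle k for @sval _ _].
HB.instance Definition _ k := [Choice of cycle k by <:].
HB.instance Definition _ k := [SubChoice_isSubZmodule of cycle k by <:].

Definition is_boundary k : {pred cycle k} :=
  fun z => `[< exists c : chain k.+1, boundary c = val z >].

Lemma is_boundary_zmod_closed k : zmod_closed (is_boundary (k := k)).
Proof.
have bB := @boundary_additive k; split.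
  by apply/asboolP; exists 0; rewrite -[0]subr0 bB subrr.
move=> x y /asboolP[c cx] /asboolP[d dy]; apply/asboolP; exists (c - d).
by rewrite bB cx dy.
Qed.

HB.instance Definition _ k :=
  GRing.isZmodClosed.Build (cycle k) (is_boundary (k := k))
    (is_boundary_zmod_closed k).

Definition homology (k : nat) : zmodType := Quotient.quot (is_boundary (k := k)).

End SingularHomology.

Definition int_independent (A : zmodType) (r : nat) (v : 'I_r -> A) : Prop :=
  forall m : 'I_r -> int, \sum_i v i *~ m i = 0 -> forall i, m i = 0.

(* The rank takes values in [0, +oo], so that it is defined without assuming the
   group to be of finite rank; R only provides the extended numbers. *)
Definition rank (R : realType) (A : zmodType) : \bar R :=
  ereal_sup [set r%:R%:E | r in
    [set r | exists v : 'I_r -> A, int_independent v]].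

Definition betti (R : realType) (k : nat) (X : topologicalType) : \bar R :=
  rank R (homology R X k).

(* Main.v *)
(** The variety is the product of a nodal cubic and the projective space P^(n-1),
    in its Segre embedding. The nodal cubic is P^1 with 0 and infinity glued: it
    is the image of [s : u] |-> [s^2 u : s u^2 : s^3 + u^3], with equation
    X Y Z = X^3 + Y^3. The action s |-> t s of C^* on P^1 fixes 0 and infinity,
    hence descends to the cubic; it does not extend linearly to the plane, but it
    is given locally by polynomials. On P^(n-1) we let t act by t^j on the j-th
    coordinate, so that the only fixed points of the product are the node times
    the n coordinate points.

    The first Betti number is positive because |s| / (|s| + |u|) is a continuous
    map from the variety to R/Z: lifting it along singular simplices gives a
    cocycle, which takes the value 1 on the loop s = v, u = 1 - v, 0 <= v <= 1.

    For the dimension, a chain Z_0 < ... < Z_m in X yields (J+1)^m forms of degree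
    O(J) that are linearly independent on X, for each J, whereas the
    parametrization by n affine parameters bounds the number of independent forms
    of degree d by (4 d + 1)^n. *)

Require Import Defs.
From HB Require Import structures.
From mathcomp Require Import -(notations) freeg mpoly.
From mathcomp Require Import all_boot all_order all_algebra.
From mathcomp Require Import all_classical all_reals all_analysis.
From mathcomp Require Import complex.
From mathcomp Require Import ring lra zify.
Require Import Defs.

Import Order.TTheory GRing.Theory Num.Theory.
Import numFieldNormedType.Exports.
Local Open Scope classical_set_scope.
Local Open Scope quotient_scope.
Local Open Scope ring_scope.

Set Implicit Arguments.
Unset Strict Implicit.
Unset Printing Implicit Defensive.

(** * Points and forms of projective space *)

Section ProjectivePoints.
Context (K : numFieldType) (N : nat).
Local Notation P := (projspace K N).
Implicit Types (v w : 'rV[K]_N.+1) (x : P).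

Lemma const_mx1_neq0 : const_mx 1 != 0 :> 'rV[K]_N.+1.
Proof. by apply/eqP => /matrixP/(_ 0 0); rewrite !mxE => /eqP; rewrite oner_eq0. Qed.

Definition nonzero_of v : nonzero_vec K N :=
  if pselect (v != 0) is left v0 then SigSub (@mem_set _ [set v : 'rV[K]_N.+1 | v != 0] v v0)
  else SigSub (@mem_set _ [set v : 'rV[K]_N.+1 | v != 0] _ const_mx1_neq0).

(* The junk value at [v = 0] is the point with all coordinates equal to 1. *)
Definition ppoint v : P := \pi_P (nonzero_of v).

Lemma set_val_nonzero_of v : v != 0 -> set_val (nonzero_of v) = v.
Proof. by rewrite /nonzero_of; case: pselect. Qed.

Lemma nonzero_vec_neq0 (u : nonzero_vec K N) : set_val u != 0.
Proof. exact: (set_mem (valP u)). Qed.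

Lemma coords_ppoint v : v != 0 -> homogeneous_coords (ppoint v) v.
Proof. by move=> v0; exists (nonzero_of v) => //; exact: set_val_nonzero_of. Qed.

Lemma coordsP x v : homogeneous_coords x v <-> v != 0 /\ x = ppoint v.
Proof.
split=> [[u <- <-]|[v0 ->]]; last exact: coords_ppoint.
split; first exact: nonzero_vec_neq0.
rewrite /ppoint; congr (\pi_P _); apply: val_inj.
exact/esym/set_val_nonzero_of/nonzero_vec_neq0.
Qed.

Lemma coords_exists x : exists v, homogeneous_coords x v.
Proof. by exists (set_val (repr x)); exists (repr x) => //; rewrite reprK. Qed.

Lemma coords_neq0 x v : homogeneous_coords x v -> v != 0.
Proof. by case/coordsP. Qed.

Lemma ppoint_eqP v w : v != 0 -> w != 0 ->
  ppoint v = ppoint w <-> exists2 c : K, c != 0 & v = c *: w.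
Proof.
move=> v0 w0; rewrite -{2}(set_val_nonzero_of v0) -{2}(set_val_nonzero_of w0).
have E : reflect (ppoint v = ppoint w) (proportional (nonzero_of v) (nonzero_of w)).
  exact: (@eqmodP _ (proportional_equiv K N)).
by split=> [/E/asboolP|h]; last exact/E/asboolP.
Qed.

Lemma ppoint_scale c v : c != 0 -> v != 0 -> ppoint (c *: v) = ppoint v.
Proof. by move=> c0 v0; apply/ppoint_eqP => //; [rewrite scaler_eq0 negb_or c0|exists c]. Qed.

Lemma coords_uniq x v w : homogeneous_coords x v -> homogeneous_coords x w ->
  exists2 c : K, c != 0 & v = c *: w.
Proof. by move=> /coordsP[v0 ->] /coordsP[w0 /ppoint_eqP]; exact. Qed.

End ProjectivePoints.

Section Polynomials.
Context (K : numFieldType) (N : nat).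
Implicit Types (f g : mpoly N.+1 K) (v : 'rV[K]_N.+1).

Lemma evalM f g v : eval (f * g) v = eval f v * eval g v.
Proof. exact: mevalM. Qed.
Lemma evalD f g v : eval (f + g) v = eval f v + eval g v.
Proof. exact: mevalD. Qed.
Lemma evalB f g v : eval (f - g) v = eval f v - eval g v.
Proof. exact: mevalB. Qed.
Lemma evalZ c f v : eval (c *: f) v = c * eval f v.
Proof. exact: mevalZ. Qed.
Lemma evalXn f k v : eval (f ^+ k) v = eval f v ^+ k.
Proof. exact: (rmorphXn (meval _)). Qed.
Lemma eval_sum (I : Type) (r : seq I) (Q : pred I) (F : I -> mpoly N.+1 K) v :
  eval (\sum_(i <- r | Q i) F i) v = \sum_(i <- r | Q i) eval (F i) v.
Proof. exact: (raddf_sum (meval _)). Qed.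
Lemma eval_coord i v : eval (mpolyX K (mnm1 i)) v = v 0 i.
Proof. exact: mevalXU. Qed.

Lemma eval_scale d f c v : homogeneous_of_degree d f ->
  eval f (c *: v) = c ^+ d * eval f v.
Proof.
move=> /dhomogP fd; rewrite /eval !mevalE mulr_sumr big_seq [RHS]big_seq.
apply: eq_bigr => m mf; rewrite mulrCA; congr (_ * _).
under eq_bigr do rewrite mxE exprMn.
rewrite big_split/=; congr (_ * _).
have <- : mdeg m = d := fd _ mf.
by rewrite mdegE expr_sum.
Qed.

Lemma homogM (A : nzRingType) m d e (f g : mpoly m A) : homogeneous_of_degree d f -> homogeneous_of_degree e g ->
  homogeneous_of_degree (d + e) (f * g).
Proof. exact: dhomogM. Qed.

Lemma homog_coord (A : nzRingType) m i :
  homogeneous_of_degree 1 (mpolyX A (@mnm1 m i)).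
Proof. by rewrite /homogeneous_of_degree dhomogX/= mdeg1. Qed.

Lemma homogXn (A : nzRingType) m d k (f : mpoly m A) : homogeneous_of_degree d f ->
  homogeneous_of_degree (d * k) (f ^+ k).
Proof. exact: dhomogMn. Qed.

Lemma homog_sum (I : Type) (r : seq I) (Q : pred I) (F : I -> mpoly N.+1 K) d :
  (forall i, Q i -> homogeneous_of_degree d (F i)) ->
  homogeneous_of_degree d (\sum_(i <- r | Q i) F i).
Proof. by move=> h; apply: rpred_sum. Qed.

(** Restricting forms to polynomial curves reduces their vanishing to a count of roots; the degree
    bound is what later controls the Hilbert function. *)
Lemma eval_curve d f c (p : 'I_N.+1 -> {poly K}) : homogeneous_of_degree d f ->
  (forall i, (size (p i) <= c.+1)%N) ->
  exists2 q : {poly K}, (size q <= (c * d).+1)%N &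
    forall t, q.[t] = eval f (\row_i (p i).[t]).
Proof.
move=> /dhomogP fd sp; exists (\sum_(m <- msupp f) mcoeff m f *: \prod_i p i ^+ m i).
  rewrite big_seq; apply: (leq_trans (size_sum _ _ _)).
  apply/bigmax_leqP_seq => m mf _; apply: leq_trans (size_scale_leq _ _) _.
  apply: leq_trans (size_prod_leq _ _) _; rewrite leq_subLR addnS ltnS.
  have -> : (c * d = \sum_i c * m i)%N by rewrite -big_distrr/= -mdegE; congr (c * _)%N; rewrite -(fd _ mf).
  rewrite -sum1_card -big_split/=.
  apply: leq_sum => i _.
  have [->|p0] := eqVneq (p i) 0.
    rewrite expr0n; case: (m i == 0)%N; rewrite ?size_poly1 ?size_poly0 ?leq_addr//.
  apply: leq_trans (size_poly_exp_leq _ _) _.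
  by rewrite add1n ltnS leq_mul2r -ltnS prednK ?size_poly_gt0// sp orbT.
move=> t; rewrite /eval mevalE horner_sum; apply: eq_bigr => m _.
rewrite hornerZ horner_prod; congr (_ * _); apply: eq_bigr => i _.
by rewrite horner_exp mxE.
Qed.

Lemma poly_eq0_of_roots (q : {poly K}) b : (size q <= b)%N ->
  (forall k, (k < b)%N -> q.[k%:R] = 0) -> q = 0.
Proof.
move=> sq q0; apply/eqP; apply: contraTT sq => qn0; rewrite -ltnNge.
rewrite -[b](size_iota 0) -(size_map (fun k => k%:R : K)).
apply: max_poly_roots => //.
  apply/allP => _ /mapP[k + ->]; rewrite mem_iota/= add0n => /q0 qk.
  exact/eqP.
by rewrite map_inj_uniq ?iota_uniq//; exact: mulrIn (oner_neq0 K).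
Qed.

Lemma poly_eq0_of_fun (q : {poly K}) : (forall t, q.[t] = 0) -> q = 0.
Proof. by move=> q0; apply: (@poly_eq0_of_roots q (size q)). Qed.
End Polynomials.

(** * Closed and irreducible sets *)

Section ZariskiClosedSets.
Context (K : numFieldType) (N : nat).
Local Notation P := (projspace K N).
Implicit Types (X Y : set P) (f g : mpoly N.+1 K).

Definition vanishes_on f X : Prop :=
  forall x v, X x -> homogeneous_coords x v -> eval f v = 0.

Lemma homog_eval_coords d f x v w : homogeneous_of_degree d f ->
  homogeneous_coords x v -> homogeneous_coords x w -> eval f v = 0 -> eval f w = 0.
Proof.
move=> fd xv xw fv; have [c c0 ->] := coords_uniq xw xv.
by rewrite (eval_scale _ _ fd) fv mulr0.
Qed.

Lemma vanishes_onW f X Y : Y `<=` X -> vanishes_on f X -> vanishes_on f Y.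
Proof. by move=> YX fX x v /YX; exact: fX. Qed.

Lemma zariski_closed_hypersurface d f : homogeneous_of_degree d f ->
  zariski_closed [set x | forall v, homogeneous_coords x v -> eval f v = 0].
Proof.
move=> fd; exists [set f] => [_ ->|]; first by exists d.
by apply/seteqP; split=> x /= h; [move=> _ v ->|move=> v]; exact: h.
Qed.

(* The zero sets of two forms cover [X] when their product vanishes on [X]. *)
Lemma irreducible_vanishes_mul d e f g X : zariski_irreducible X ->
  homogeneous_of_degree d f -> homogeneous_of_degree e g ->
  vanishes_on (f * g) X -> vanishes_on f X \/ vanishes_on g X.
Proof.
move=> [_ irr] fd ge fg.
have [|h|h] := irr _ _ (zariski_closed_hypersurface fd)
    (zariski_closed_hypersurface ge).
- move=> x Xx; have [v xv] := coords_exists x.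
  have /eqP := fg _ _ Xx xv; rewrite evalM mulf_eq0 => /orP[]/eqP h.
    by left=> w xw; exact: homog_eval_coords fd xv xw h.
  by right=> w xw; exact: homog_eval_coords ge xv xw h.
- by left=> x v /h; exact.
- by right=> x v /h; exact.
Qed.

Lemma irreducible_vanishes_exp d f k X : zariski_irreducible X ->
  homogeneous_of_degree d f -> vanishes_on (f ^+ k) X -> vanishes_on f X.
Proof.
move=> Xirr fd; elim: k => [h|k IH]; last first.
  by rewrite exprS => /(irreducible_vanishes_mul Xirr fd (homogXn k fd))[|/IH].
have [[x Xx] _] := Xirr; have [v xv] := coords_exists x.
by have /eqP := h _ _ Xx xv; rewrite evalXn expr0 oner_eq0.
Qed.

(** If [A] misses [x] and [B] misses [y], a form defining [A] is nonzero at [x] and one defining [B]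
    is nonzero at [y]. Along a curve from [x] to [y] both become nonzero polynomials in one
    variable, whereas covering [X] by [A] and [B] forces their product to vanish. *)
Lemma irreducible_of_curves X : X !=set0 ->
  (forall x y, X x -> X y -> exists p : 'I_N.+1 -> {poly K},
    [/\ homogeneous_coords x (\row_i (p i).[0]),
        homogeneous_coords y (\row_i (p i).[1]) &
        forall t, \row_i (p i).[t] != 0 -> X (ppoint (\row_i (p i).[t]))]) ->
  zariski_irreducible X.
Proof.
move=> X0 curves; split=> // A B [S Sh AE] [T Th BE] XAB.
apply: contrapT => /not_orP[/existsNP[x /not_implyP[Xx Ax]]].
move=> /existsNP[y /not_implyP[Xy By]].
have [f Sf [v [xv fv]]] : exists2 f, S f &
    exists v, homogeneous_coords x v /\ eval f v <> 0.
  apply: contrapT => h; apply: Ax; rewrite AE => f v Sf xv.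
  by apply: contrapT => fv; apply: h; exists f => //; exists v.
have [g Tg [w [yw gw]]] : exists2 f, T f &
    exists v, homogeneous_coords y v /\ eval f v <> 0.
  apply: contrapT => h; apply: By; rewrite BE => g w Sg yw.
  by apply: contrapT => gw; apply: h; exists g => //; exists w.
have [[d fd] [e ge]] := (Sh _ Sf, Th _ Tg).
have [p [xp yp Xp]] := curves x y Xx Xy.
pose c := (\max_i size (p i))%N.
have pc i : (size (p i) <= c.+1)%N.
  by rewrite leqW// /c leq_bigmax.
have [qf _ qfE] := eval_curve fd pc; have [qg _ qgE] := eval_curve ge pc.
have [i pi0] : exists i, p i != 0.
  apply/existsP; rewrite -negb_forall; apply/negP => /forallP h.
  have /eqP[] := coords_neq0 xp; apply/rowP => i.
  by rewrite !mxE (eqP (h i)) horner0.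
(* The factor [p i] absorbs the parameters where the curve passes through the zero vector and
   defines no point. *)
have : qf * qg * p i = 0.
  apply: poly_eq0_of_fun => t; rewrite !hornerM qfE qgE.
  have [->|pt] := eqVneq (p i).[t] 0; first by rewrite mulr0.
  have pt0 : \row_i (p i).[t] != 0.
    by apply: contraNneq pt => /rowP/(_ i); rewrite !mxE => ->.
  have := XAB _ (Xp _ pt0); rewrite AE BE => -[h|h].
    by rewrite (h _ _ Sf (coords_ppoint pt0)) !mul0r.
  by rewrite (h _ _ Tg (coords_ppoint pt0)) mulr0 mul0r.
move=> /eqP; rewrite !mulf_eq0 (negPf pi0) orbF => /orP[]/eqP q0.
  apply: fv; apply: homog_eval_coords fd xp xv _.
  by rewrite -qfE q0 horner0.
apply: gw; apply: homog_eval_coords ge yp yw _.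
by rewrite -qgE q0 horner0.
Qed.

End ZariskiClosedSets.

(** * Hilbert functions and dimension *)

Section DimensionBound.
Context (K : numFieldType) (N : nat).
Local Notation P := (projspace K N).
Implicit Types (X Y : set P) (f g : mpoly N.+1 K).

Definition independent_on (T : finType) (g : T -> mpoly N.+1 K) X : Prop :=
  forall c : T -> K, vanishes_on (\sum_k c k *: g k) X -> forall k, c k = 0.

(* The Hilbert function of [X] at [d] is at least [r]. *)
Definition hilbert_ge X d r : Prop := exists (T : finType)
  (g : T -> mpoly N.+1 K), [/\ #|T| = r,
    forall k, homogeneous_of_degree d (g k) & independent_on g X].

Lemma hilbert_ge_sub X Y d r : Y `<=` X -> hilbert_ge Y d r -> hilbert_ge X d r.
Proof.
move=> YX [T [g [Tr gd gY]]]; exists T, g; split=> // c cX.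
by apply: gY; exact: vanishes_onW cX.
Qed.

Lemma hilbert_ge_point X : X !=set0 -> hilbert_ge X 0 1.
Proof.
move=> [x Xx]; exists unit, (fun=> 1); split=> [|_|c h []]; first exact: card_unit.
  exact: dhomog1.
have [v xv] := coords_exists x.
have := h _ _ Xx xv; rewrite eval_sum (bigD1 tt)//= big1; last by case.
by rewrite addr0 evalZ /eval meval1 mulr1.
Qed.

(* The products f^a x^(e(J-a)) g, where f is a form of degree e vanishing on Y
   but not on X, x is a coordinate that does not vanish on Y, 0 <= a <= J, and
   g runs over an independent family on Y, are independent on X. *)
Lemma hilbert_ge_step X Y : projective_variety X -> projective_variety Y ->
  Y `<` X -> exists e, forall d r J, hilbert_ge Y d r ->
    hilbert_ge X (e * J + d) (J.+1 * r).
Proof.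
move=> [_ Xirr] [[S Sh YE] Yirr]; rewrite properEneq => -[YneX YX].
have [x Xx Yx] : exists2 x, X x & ~ Y x.
  apply: contrapT => h; move/eqP: YneX; apply; apply/seteqP; split=> // x Xx.
  by apply: contrapT => Yx; apply: h; exists x.
have [f Sf [v [xv fv]]] : exists2 f, S f &
    exists v, homogeneous_coords x v /\ eval f v <> 0.
  apply: contrapT => h; apply: Yx; rewrite YE => f v Sf xv.
  by apply: contrapT => fv; apply: h; exists f => //; exists v.
have [e fe] := Sh _ Sf.
have fY : vanishes_on f Y by move=> y w; rewrite YE => h; exact: h.
have fX : ~ vanishes_on f X by move=> h; apply: fv; exact: h xv.
have [[y Yy] _] := Yirr; have [w yw] := coords_exists y.
have [i wi] : exists i, w 0 i != 0.
  apply/existsP; rewrite -negb_forall; apply/negP => /forallP h.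
  by have /eqP[] := coords_neq0 yw; apply/rowP => i; rewrite mxE (eqP (h i)).
pose l : mpoly N.+1 K := mpolyX K (mnm1 i).
have l1 : homogeneous_of_degree 1 l by exact: homog_coord.
have lY : ~ vanishes_on l Y.
  by move=> h; move/eqP: wi; apply; rewrite -eval_coord (h _ _ Yy yw).
exists e => d r J [T [g [Tr gd gY]]].
pose F (ak : 'I_J.+1 * T) := f ^+ ak.1 * l ^+ (e * (J - ak.1)) * g ak.2.
exists ('I_J.+1 * T)%type, F; split; first by rewrite card_prod card_ord Tr.
  move=> [a k]; rewrite /F/=.
  have -> : (e * J + d = e * a + 1 * (e * (J - a)) + d)%N.
    by rewrite mul1n -mulnDr subnKC// -ltnS.
  by apply: homogM => //; apply: homogM; exact: homogXn.
move=> c cX.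
(* Induction on the exponent of [f]: coefficients with exponent below [m] vanish. *)
suff H m : forall (a : 'I_J.+1) k, (a < m)%N -> c (a, k) = 0.
  by case=> a k; exact: (H a.+1).
elim: m => [//|m IH] a k; rewrite ltnS leq_eqVlt => /orP[/eqP am|/IH//].
have aJ : (a <= J)%N by rewrite -ltnS.
pose G b k' := f ^+ (b - a) * l ^+ (e * (J - b)) * g k'.
(* What remains of the combination is f^a times [h]; as [X] is irreducible and [f] is not zero on
   it, [h] vanishes on [X]. *)
pose h := \sum_(bk : 'I_J.+1 * T | (a <= bk.1)%N) c bk *: G bk.1 bk.2.
have hd : homogeneous_of_degree (e * (J - a) + d) h.
  apply: homog_sum => -[b k'] /= ab; apply: dhomogZ.
  have bJ : (b <= J)%N by rewrite -ltnS.
  have -> : (e * (J - a) + d = e * (b - a) + 1 * (e * (J - b)) + d)%N.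
    by rewrite mul1n -mulnDr; congr (e * _ + _)%N; lia.
  by apply: homogM => //; apply: homogM; exact: homogXn.
have hE : \sum_bk c bk *: F bk = f ^+ a * h.
  rewrite (bigID (fun bk : 'I_J.+1 * T => (a <= bk.1)%N))/= [X in _ + X]big1.
    rewrite addr0 /h mulr_sumr; apply: eq_bigr => -[b k'] /= ab.
    by rewrite /F/G/= -scalerAr !mulrA -exprD subnKC.
  by move=> [b k'] /=; rewrite -ltnNge am => /IH ->; rewrite scale0r.
have hX : vanishes_on h X.
  have := irreducible_vanishes_mul Xirr (homogXn a fe) hd.
  rewrite -hE => /(_ cX)[/(irreducible_vanishes_exp Xirr fe)|//].
  by move=> /fX.
pose g0 := \sum_k' c (a, k') *: g k'.
have g0d : homogeneous_of_degree d g0.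
  by apply: homog_sum => k' _; apply: dhomogZ; exact: gd.
(* On [Y], where [f] vanishes, only the terms of [h] with exponent exactly [a] survive; cancelling
   the power of [l] leaves a relation among the [g]. *)
have : vanishes_on (l ^+ (e * (J - a)) * g0) Y.
  move=> z u Yz zu; rewrite -(hX z u (YX _ Yz) zu) /h eval_sum.
  rewrite (bigID (fun bk : 'I_J.+1 * T => bk.1 == a))/= [X in _ + X]big1; last first.
    move=> [b k'] /= /andP[ab ba]; have {}ab : (a < b)%N.
      by rewrite ltn_neqAle ab eq_sym ba.
    by rewrite evalZ !evalM evalXn (fY _ _ Yz zu) expr0n subn_eq0 leqNgt ab/= !mul0r mulr0.
  rewrite addr0 evalM /g0 eval_sum mulr_sumr.
  rewrite (reindex_onto (fun k' => (a, k')) (fun bk => bk.2))/=; last first.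
    by move=> [b k'] /= /andP[_ /eqP ->].
  apply: eq_big => [k'|k' _]; first by rewrite leqnn !eqxx.
  rewrite !evalZ /G !evalM subnn expr0 /eval meval1 mul1r; ring.
case/(irreducible_vanishes_mul Yirr (homogXn _ l1) g0d) => [|g0Y].
  by move=> /(irreducible_vanishes_exp Yirr l1)/lY.
exact: gY g0Y k.
Qed.

(** Starting from the constant form on [Z 0], each step up the chain multiplies the number of
    independent forms by J + 1 and adds a fixed multiple of J to the degree. *)
Lemma hilbert_ge_chain X m Z : irreducible_chain X m Z ->
  exists E, forall J, hilbert_ge X (E * J) (J.+1 ^ m).
Proof.
move=> [ZX Zlt].
suff [E H] : exists E, forall J, hilbert_ge (Z m) (E * J) (J.+1 ^ m).
  by exists E => J; apply: hilbert_ge_sub (H J); exact: (ZX m (leqnn m)).2.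
suff H i : (i <= m)%N -> exists E, forall J, hilbert_ge (Z i) (E * J) (J.+1 ^ i).
  exact: H.
elim: i => [_|i IH im].
  by exists 0%N => J; apply: hilbert_ge_point; have [[_ []]] := ZX 0%N isT.
have [E HE] := IH (ltnW im).
have [e He] := hilbert_ge_step (ZX _ im).1 (ZX _ (ltnW im)).1 (Zlt _ im).
by exists (e + E)%N => J; rewrite mulnDl expnS; exact: He.
Qed.

(* The Hilbert function of [X] at [d] is at most [r]. *)
Definition hilbert_le X d r : Prop := exists w : 'I_r -> 'rV[K]_N.+1,
  forall f, homogeneous_of_degree d f -> (forall k, eval f (w k) = 0) ->
    vanishes_on f X.

(** With more forms than sample points, the matrix of values has a nonzero left kernel: a nontrivial
    combination vanishes at all sample points, hence on [X]. *)
Lemma hilbert_ge_le X d r s : hilbert_ge X d r -> hilbert_le X d s -> (r <= s)%N.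
Proof.
move=> [T [g [<- gd gX]]] [w wX]; rewrite leqNgt; apply/negP => sr.
pose A := \matrix_(i < #|T|, j < s) eval (g (enum_val i)) (w j).
have : kermx A != 0.
  rewrite -mxrank_eq0 mxrank_ker subn_eq0 -ltnNge.
  exact: leq_ltn_trans (rank_leq_col _) sr.
move=> /rowV0Pn[c /sub_kermxP cA c0]; move/eqP: c0; apply; apply/rowP => i.
rewrite mxE -(enum_valK i).
apply: (gX (fun k => c 0 (enum_rank k))).
apply: wX => [|j]; first by apply: homog_sum => k _; apply: dhomogZ; exact: gd.
have /rowP/(_ j) := cA; rewrite !mxE => <-; rewrite eval_sum.
rewrite (reindex (@enum_val T T)) /=; last by apply: onW_bij; exact: enum_val_bij.
by apply: eq_bigr => k _; rewrite evalZ enum_valK mxE.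
Qed.

Lemma chain_length_le X n c m Z :
  (forall d, hilbert_le X d ((c * d).+1 ^ n)) ->
  irreducible_chain X m Z -> (m <= n)%N.
Proof.
move=> Xle /hilbert_ge_chain[E XE]; rewrite leqNgt; apply/negP => nm.
(* For this J, (c E J + 1)^n <= ((c E + 1) (J + 1))^n = J (J + 1)^n < (J + 1)^(n + 1), which
   contradicts n < m. *)
pose J := ((c * E).+1 ^ n)%N.
have := hilbert_ge_le (XE J) (Xle _).
apply/negP; rewrite -ltnNge mulnA.
apply: (@leq_ltn_trans (((c * E).+1 * J.+1) ^ n)%N).
  by case: (n) => [//|n']; rewrite leq_exp2r//; nia.
rewrite expnMn -/J; apply: (@leq_trans (J.+1 ^ n.+1)%N).
  by rewrite expnS ltn_mul2r expn_gt0/= ltnSn.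
by rewrite leq_pexp2l.
Qed.

End DimensionBound.

(** * Coordinate linear subspaces *)

Section CoordinateSubspaces.
Context (K : numFieldType) (N : nat).
Local Notation P := (projspace K N).
Implicit Types Q : pred 'I_N.+1.

Definition coord_subspace Q : set P :=
  [set x | forall v, homogeneous_coords x v -> forall k, ~~ Q k -> v 0 k = 0].

Lemma coord_subspace_ppoint Q v : v != 0 ->
  coord_subspace Q (ppoint v) <-> forall k, ~~ Q k -> v 0 k = 0.
Proof.
move=> v0; split=> [|h w]; first by move=> /(_ _ (coords_ppoint v0)).
move=> /(coords_uniq (coords_ppoint v0))[c c0 vE] k Qk.
have /eqP := h k Qk; rewrite vE mxE mulf_eq0 (negPf c0) => /eqP; exact.
Qed.

Lemma delta_neq0 k : delta_mx 0 k != 0 :> 'rV[K]_N.+1.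
Proof. by apply/eqP => /rowP/(_ k); rewrite !mxE !eqxx => /eqP; rewrite oner_eq0. Qed.

Lemma coord_subspace_delta Q k :
  coord_subspace Q (ppoint (delta_mx 0 k)) <-> Q k.
Proof.
rewrite coord_subspace_ppoint ?delta_neq0//; split=> [|Qk j Qj].
  apply: contraPT => Qk /(_ k Qk); rewrite mxE !eqxx => /eqP; apply/negP.
  exact: oner_neq0.
by rewrite mxE eqxx; case: eqP Qk Qj => [->|//] ->.
Qed.

Lemma coord_subspace_variety Q k : Q k -> projective_variety (coord_subspace Q).
Proof.
move=> Qk; split.
  exists [set f | exists2 j, ~~ Q j & f = mpolyX K (mnm1 j)].
    by move=> _ [j _ ->]; exists 1%N; exact: homog_coord.
  apply/seteqP; split=> x /= h; first by move=> _ v [j Qj ->] xv; rewrite eval_coord (h v).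
  by move=> v xv j Qj; rewrite -eval_coord; apply: h => //; exists j.
apply: irreducible_of_curves.
  by exists (ppoint (delta_mx 0 k)); apply/coord_subspace_delta.
move=> x y Qx Qy; have [v xv] := coords_exists x; have [w yw] := coords_exists y.
exists (fun i => (v 0 i)%:P + (w 0 i - v 0 i) *: 'X); split.
- by rewrite (_ : \row_i _ = v)//; apply/rowP => i; rewrite mxE hornerD hornerC hornerZ hornerX mulr0 addr0.
- by rewrite (_ : \row_i _ = w)//; apply/rowP => i; rewrite mxE hornerD hornerC hornerZ hornerX mulr1 subrKC.
- move=> t t0; apply/coord_subspace_ppoint => // j Qj.
  by rewrite mxE !hornerE (Qx v xv j Qj) (Qy w yw j Qj) subrr mul0r addr0.
Qed.

Lemma coord_subspace_sub Q Q' : {subset Q <= Q'} ->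
  coord_subspace Q `<=` coord_subspace Q'.
Proof. by move=> QQ x h v xv k Qk; apply: h => //; apply: contra Qk; exact: QQ. Qed.

End CoordinateSubspaces.

(** Interpolation one variable at a time: a polynomial of size at most [B] with [B] distinct roots
    is zero. *)
Lemma grid_vanish (K : numFieldType) n B (g : ('I_n -> K) -> K) :
  (forall z i, exists2 q : {poly K}, (size q <= B)%N &
    forall t, q.[t] = g (fun j => if j == i then t else z j)) ->
  (forall e : {ffun 'I_n -> 'I_B}, g (fun j => (e j)%:R) = 0) ->
  forall z, g z = 0.
Proof.
move=> gq g0.
(* Variables of index below [m] are arbitrary, the others still lie on the grid. *)
suff H m : forall z, (forall j : 'I_n, (m <= j)%N -> exists k : 'I_B, z j = k%:R) ->
    g z = 0.
  by move=> z; apply: (H n) => j; rewrite leqNgt ltn_ord.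
elim: m => [z zB|m IH z zB].
  have [e eE] := choice (fun j => zB j isT).
  rewrite (_ : z = fun j => ([ffun j => e j] j)%:R) ?g0//.
  by apply/funext => j; rewrite eE ffunE.
have [nm|mn] := leqP n m.
  by apply: IH => j /(leq_trans nm); rewrite leqNgt ltn_ord.
have [q sq qE] := gq z (Ordinal mn).
have q0 : q = 0.
  apply: (poly_eq0_of_roots sq) => k kB; rewrite qE; apply: IH => j mj.
  have [jm|jm] := eqVneq j (Ordinal mn); first by exists (Ordinal kB).
  by apply: zB; rewrite ltn_neqAle mj andbT eq_sym.
rewrite (_ : z = fun j => if j == Ordinal mn then z (Ordinal mn) else z j).
  by rewrite -qE q0 horner0.
by apply/funext => j; case: eqP => [->|].
Qed.

(** * The product of the nodal cubic and a projective space *)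

Definition row0 : 'I_3 := @Ordinal 3 0 isT.
Definition row1 : 'I_3 := @Ordinal 3 1 isT.
Definition row2 : 'I_3 := @Ordinal 3 2 isT.

Lemma ord3P (Q : 'I_3 -> Prop) : Q row0 -> Q row1 -> Q row2 -> forall i, Q i.
Proof.
move=> Q0 Q1 Q2 [[|[|[|//]]] i3].
- by rewrite (_ : Ordinal i3 = row0)//; exact: ord_inj.
- by rewrite (_ : Ordinal i3 = row1)//; exact: ord_inj.
- by rewrite (_ : Ordinal i3 = row2)//; exact: ord_inj.
Qed.

Section Segre.
Context (n : nat).

(* The 3 x (n+1) matrices, flattened row by row, are the vectors of length N+1. *)
Definition segreN : nat := (3 * n + 2)%N.
Definition mxpos (i : 'I_3) (j : 'I_n.+1) : 'I_segreN.+1 := inord (i * n.+1 + j).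
Definition rowpos (k : 'I_segreN.+1) : 'I_3 := inord (k %/ n.+1).
Definition colpos (k : 'I_segreN.+1) : 'I_n.+1 := inord (k %% n.+1).

Lemma val_mxpos i j : mxpos i j = (i * n.+1 + j)%N :> nat.
Proof.
rewrite /mxpos inordK// /segreN.
by have := ltn_ord i; have := ltn_ord j; nia.
Qed.

Lemma mxposK1 i j : rowpos (mxpos i j) = i.
Proof.
by apply: ord_inj; rewrite /rowpos val_mxpos divnMDl// divn_small// addn0 inordK.
Qed.

Lemma mxposK2 i j : colpos (mxpos i j) = j.
Proof. by apply: ord_inj; rewrite /colpos val_mxpos modnMDl modn_small// inordK. Qed.

Lemma mxposK k : mxpos (rowpos k) (colpos k) = k.
Proof.
apply: ord_inj; rewrite val_mxpos /rowpos /colpos !inordK -?divn_eq//.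
  exact: ltn_pmod.
by rewrite ltn_divLR//; have := ltn_ord k; rewrite /segreN; lia.
Qed.

Definition segre (A : comNzRingType) (c : 'I_3 -> A) (y : 'I_n.+1 -> A) :
  'rV[A]_segreN.+1 := \row_k (c (rowpos k) * y (colpos k)).

Lemma segreE (A : comNzRingType) (c : 'I_3 -> A) y i j :
  segre c y 0 (mxpos i j) = c i * y j.
Proof. by rewrite mxE mxposK1 mxposK2. Qed.

Lemma eq_rowpos (A : comNzRingType) (v w : 'rV[A]_segreN.+1) :
  (forall i j, v 0 (mxpos i j) = w 0 (mxpos i j)) -> v = w.
Proof. by move=> h; apply/rowP => k; rewrite -(mxposK k). Qed.

(** The ring is arbitrary because the formula is used on scalars, on polynomials in one variable and
    on real barycentric coordinates. Both (1, 0) and (0, 1) give the node (0, 0, 1). *)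
Definition nodal (A : comNzRingType) (s u : A) (i : 'I_3) : A :=
  match val i with
  | 0 => s ^+ 2 * u
  | 1 => s * u ^+ 2
  | _ => s ^+ 3 + u ^+ 3
  end.

Definition param (A : comNzRingType) (s u : A) (y : 'I_n.+1 -> A) :=
  segre (nodal s u) y.

Lemma param_scale (A : comNzRingType) c (s u : A) y :
  c *: param s u y = param s u (fun j => c * y j).
Proof. by apply/rowP => k; rewrite !mxE mulrCA. Qed.

Lemma horner_nodal (A : comNzRingType) (s u : {poly A}) i t :
  (nodal s u i).[t] = nodal s.[t] u.[t] i.
Proof. by move: i; apply: ord3P; rewrite /nodal/= !hornerE. Qed.

Context (K : numFieldType).
Local Notation P := (projspace K segreN).

Lemma nodal_neq0 (s u : K) : (s != 0) || (u != 0) -> exists i, nodal s u i != 0.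
Proof.
have [->|s0 _] := eqVneq s 0; have [->|u0] := eqVneq u 0 => //=.
- by exists row2; rewrite /nodal/= expr0n/= add0r expf_neq0.
- by exists row2; rewrite /nodal/= [X in _ + X]expr0n/= addr0 expf_neq0.
- by exists row0; rewrite /nodal/= mulf_neq0// expf_neq0.
Qed.

Lemma param_neq0 (s u : K) y :
  param s u y != 0 <-> (s != 0) || (u != 0) /\ exists k, y k != 0.
Proof.
split=> [p0|[/nodal_neq0[i ci] [k yk]]]; last first.
  apply/eqP => /rowP/(_ (mxpos i k)); rewrite segreE mxE => /eqP.
  by rewrite mulf_eq0 (negPf ci) (negPf yk).
split.
  apply: contraNT p0; rewrite negb_or !negbK => /andP[/eqP-> /eqP->].
  apply/eqP/eq_rowpos => i j; rewrite segreE mxE.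
  by move: i; apply: ord3P; rewrite /nodal/= !expr0n/= ?mul0r ?mulr0// addr0 mul0r.
apply/existsP; apply: contraNT p0; rewrite negb_exists => /forallP y0.
apply/eqP/eq_rowpos => i j; rewrite segreE mxE.
by move: (y0 j); rewrite negbK => /eqP->; rewrite mulr0.
Qed.

(** Entries of [param] have degree 3 in (s, u) and degree 1 in y, hence degree at most 4 along a
    line of parameters. *)
Lemma param_line d (f : mpoly segreN.+1 K) (s0 s1 u0 u1 : K) y0 y1 :
  homogeneous_of_degree d f ->
  exists2 q : {poly K}, (size q <= (4 * d).+1)%N & forall t,
    q.[t] = eval f (param (s0 + s1 * t) (u0 + u1 * t) (fun j => y0 j + y1 j * t)).
Proof.
pose l (a b : K) : {poly K} := a%:P + b *: 'X.
have sl a b : (size (l a b) <= 2)%N.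
  rewrite (leq_trans (size_polyD _ _))// geq_max (leq_trans (size_polyC_leq1 _))//=.
  by rewrite (leq_trans (size_scale_leq _ _))// size_polyX.
have lE a b t : (l a b).[t] = a + b * t by rewrite /l !hornerE.
have sM a b (p q : {poly K}) : (size p <= a.+1)%N -> (size q <= b.+1)%N ->
    (size (p * q)%R <= (a + b).+1)%N.
  by move=> pa qb; rewrite (leq_trans (size_polyMleq _ _))//; lia.
have sX k (p : {poly K}) : (size p <= 2)%N -> (size (p ^+ k)%R <= k.+1)%N.
  move=> p2; rewrite (leq_trans (size_poly_exp_leq _ _))// ltnS.
  by rewrite -{2}[k]mul1n leq_mul2r; lia.
move=> fd.
have [|q sq qE] := @eval_curve _ _ d f 4
    (fun k => nodal (l s0 s1) (l u0 u1) (rowpos k) * l (y0 (colpos k)) (y1 (colpos k))) fd.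
  move=> k; apply: (@sM 3 1) => //; move: (rowpos k).
  apply: ord3P; rewrite /nodal/=.
  - by apply: (@sM 2 1) => //; exact: sX.
  - by apply: (@sM 1 2) => //; exact: sX.
  - by rewrite (leq_trans (size_polyD _ _))// geq_max !sX.
exists q => // t; rewrite qE; congr eval; apply/rowP => k.
by rewrite !mxE hornerM horner_nodal !lE.
Qed.

Definition nodal_cone (v : 'rV[K]_segreN.+1) : Prop :=
  exists s u y, v = param s u y.

Definition nodal_variety : set P :=
  [set x | forall v, homogeneous_coords x v -> nodal_cone v].

Lemma nodal_cone_scale c v : nodal_cone v -> nodal_cone (c *: v).
Proof. by move=> [s [u [y ->]]]; exists s, u, (fun j => c * y j); rewrite param_scale. Qed.

Lemma nodal_variety_ppoint v : v != 0 -> nodal_variety (ppoint v) <-> nodal_cone v.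
Proof.
move=> v0; split=> [h|vc w xw]; first exact/h/coords_ppoint.
have [c _ ->] := coords_uniq xw (coords_ppoint v0); exact: nodal_cone_scale.
Qed.

Lemma nodal_varietyP x : nodal_variety x ->
  exists s u y, [/\ param s u y != 0, x = ppoint (param s u y) &
    homogeneous_coords x (param s u y)].
Proof.
move=> Xx; have [v xv] := coords_exists x; have [s [u [y vE]]] := Xx _ xv.
by exists s, u, y; have /coordsP[v0 ->] := xv; rewrite -vE; split => //; exact: coords_ppoint.
Qed.

Definition entry (v : 'rV[K]_segreN.+1) i j := v 0 (mxpos i j).

(** The 2 x 2 minors make every column a multiple of one nonzero column, and the cubic equation puts
    that column on the nodal cubic, where s and u can be recovered. *)
Lemma nodal_coneP v : nodal_cone v <->
  (forall i j k l, entry v i j * entry v k l = entry v i l * entry v k j) /\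
  (forall j, entry v row0 j * entry v row1 j * entry v row2 j =
             entry v row0 j ^+ 3 + entry v row1 j ^+ 3).
Proof.
split=> [[s [u [y ->]]]|[minor cubic]].
  split=> [i j k l|j]; rewrite /entry !segreE; first by rewrite mulrACA [y j * _]mulrC mulrACA.
  by rewrite /nodal/=; ring.
have [->|v0] := eqVneq v 0.
  by exists 0, 0, (fun=> 0); apply/rowP => k; rewrite !mxE mulr0.
have [l [k vlk]] : exists l k, entry v l k != 0.
  have /rV0Pn[a va] := v0; exists (rowpos a), (colpos a).
  by rewrite /entry mxposK.
pose c i := entry v i k.
have vE i j : entry v i j = c i * entry v l j / c l.
  by apply: (mulIf vlk); rewrite mulfVK// minor mulrC.
have cc := cubic k; rewrite -!/(c _) in cc.
(* If X = 0 the cubic gives Y = 0: the column is the node, reached at (s, u) = (0, 1). *)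
have [c0|c0] := eqVneq (c row0) 0.
  have c1 : c row1 = 0.
    move/eqP: cc; rewrite c0 !mul0r expr0n/= add0r eq_sym expf_eq0/=.
    by move/eqP.
  exists 0, 1, (fun j => c row2 * entry v l j / c l).
  apply: eq_rowpos => i j; rewrite segreE -/(entry v i j) vE.
  move: i; apply: ord3P; rewrite /nodal/= ?c0 ?c1 ?expr0n/= ?expr1n ?mul0r//.
  by rewrite add0r mul1r.
have c1 : c row1 != 0.
  apply: contraNneq c0 => c1; move/eqP: cc; rewrite c1 mulr0 mul0r [X in _ + X]expr0n/= addr0.
  by rewrite eq_sym expf_eq0.
(* Off the node take (s, u) = (X, Y): on the cubic, [nodal X Y] is X Y times (X, Y, Z), and the
   factor X Y is divided out in y. *)
exists (c row0), (c row1), (fun j => entry v l j / (c l * c row0 * c row1)).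
apply: eq_rowpos => i j; rewrite segreE -/(entry v i j) vE.
have cl : c l != 0 by [].
move: i; apply: ord3P; rewrite /nodal/= -?cc; field; by rewrite ?cl ?c0 ?c1.
Qed.

Lemma nodal_variety_closed : zariski_closed nodal_variety.
Proof.
pose x i j : mpoly segreN.+1 K := mpolyX K (mnm1 (mxpos i j)).
have x1 i j : homogeneous_of_degree 1 (x i j) by exact: homog_coord.
have xE i j v : eval (x i j) v = entry v i j by exact: eval_coord.
exists ([set f | exists i j k l, f = x i j * x k l - x i l * x k j] `|`
        [set f | exists j, f = x row0 j * x row1 j * x row2 j -
                               (x row0 j ^+ 3 + x row1 j ^+ 3)]).
  move=> f [[i [j [k [l ->]]]]|[j ->]].
    by exists 2%N; apply: rpredB; exact: (@homogM _ _ 1 1).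
  exists 3%N; apply: rpredB; first by apply: (@homogM _ _ 2 1) => //; exact: (@homogM _ _ 1 1).
  by apply: rpredD; exact: (@homogXn _ _ 1 3).
apply/seteqP; split=> p /= h.
  move=> f v + pv; have /nodal_coneP[minor cubic] := h v pv.
  move=> [[i [j [k [l ->]]]]|[j ->]].
    by rewrite evalB !evalM !xE minor subrr.
  by rewrite evalB evalD !evalXn !evalM !xE cubic subrr.
move=> v pv; apply/nodal_coneP; split=> [i j k l|j].
  have /eqP : eval (x i j * x k l - x i l * x k j) v = 0.
    by apply: h => //; left; exists i, j, k, l.
  by rewrite evalB !evalM !xE subr_eq0 => /eqP.
have /eqP : eval (x row0 j * x row1 j * x row2 j -
                               (x row0 j ^+ 3 + x row1 j ^+ 3)) v = 0.
  by apply: h => //; right; exists j.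
by rewrite evalB evalD !evalXn !evalM !xE subr_eq0 => /eqP.
Qed.

Lemma nodal_variety_param (s u : K) y : param s u y != 0 ->
  nodal_variety (ppoint (param s u y)).
Proof. by move=> p0; apply/nodal_variety_ppoint => //; exists s, u, y. Qed.

(** Two points are joined by the image of the line between their parameters. *)
Lemma nodal_variety_irreducible : zariski_irreducible nodal_variety.
Proof.
apply: irreducible_of_curves.
  exists (ppoint (param 1 0 (fun=> 1))); apply: nodal_variety_param.
  by apply/param_neq0; rewrite oner_neq0; split=> //; exists ord0.
move=> a b /nodal_varietyP[s [u [y [_ _ ap]]]] /nodal_varietyP[s' [u' [y' [_ _ bp]]]].
pose l (a b : K) : {poly K} := a%:P + (b - a) *: 'X.
have lE t : \row_i (param (l s s') (l u u') (fun j => l (y j) (y' j)) 0 i).[t] =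
    param (l s s').[t] (l u u').[t] (fun j => (l (y j) (y' j)).[t]).
  by apply/rowP => k; rewrite !mxE hornerM horner_nodal.
have l0 (c d : K) : (l c d).[0] = c by rewrite /l hornerD hornerC hornerZ hornerX mulr0 addr0.
have l1 (c d : K) : (l c d).[1] = d by rewrite /l hornerD hornerC hornerZ hornerX mulr1 subrKC.
exists (fun k => param (l s s') (l u u') (fun j => l (y j) (y' j)) 0 k).
split=> [||t]; rewrite lE.
- by rewrite !l0; under [X in param _ _ X]funext do rewrite l0.
- by rewrite !l1; under [X in param _ _ X]funext do rewrite l1.
- exact: nodal_variety_param.
Qed.

(** A form vanishing on a grid in the affine chart u = 1, y_0 = 1 vanishes on the chart by
    interpolation, then wherever u and y_0 are nonzero by homogeneity, then everywhere by density
    along lines. *)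
Lemma nodal_hilbert_le d : hilbert_le nodal_variety d ((4 * d).+1 ^ n.+1).
Proof.
pose B := (4 * d).+1.
(* As y_0 is normalized to 1, the slot [ord0] of [z] is free to hold s. *)
pose aff (z : 'I_n.+1 -> K) := param (z ord0) 1 (fun j => if j == ord0 then 1 else z j).
have cardB : #|{ffun 'I_n.+1 -> 'I_B}| = (B ^ n.+1)%N by rewrite card_ffun !card_ord.
exists (fun k => aff (fun j => ((enum_val (cast_ord (esym cardB) k)) j)%:R)) => f fd f0.
have faff : forall z, eval f (aff z) = 0.
  apply: (@grid_vanish _ _ B) => [z i|e]; last first.
    have := f0 (cast_ord cardB (enum_rank e)).
    by rewrite cast_ordK enum_rankK.
  pose m (j : 'I_n.+1) : K := if j == i then 0 else z j.
  have [q sq qE] := @param_line d f (m ord0) (ord0 == i)%:R 1 0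
    (fun j => if j == ord0 then 1 else m j)
    (fun j => if j == ord0 then 0 else (j == i)%:R) fd.
  exists q => // t; rewrite qE /aff/m; congr (eval f (param _ _ _)).
  - by case: eqP; rewrite ?add0r ?mul1r ?mul0r ?addr0.
  - by rewrite mul0r addr0.
  - apply/funext => j; case: eqP; rewrite ?mul0r ?addr0//.
    by case: eqP; rewrite ?add0r ?mul1r ?mul0r ?addr0.
have fgen (s u : K) (y : 'I_n.+1 -> K) : u != 0 -> y ord0 != 0 -> eval f (param s u y) = 0.
  move=> u0 y0.
  have -> : param s u y = (u ^+ 3 * y ord0) *: aff (fun j => if j == ord0 then s / u
      else y j / y ord0).
    rewrite /aff eqxx param_scale; apply/eq_rowpos => i j; rewrite !segreE.
    have [->|j0] := eqVneq j ord0; move: i; apply: ord3P;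
      rewrite /nodal/= ?expr1n ?mulr1; field; by rewrite ?u0 ?y0.
  by rewrite (eval_scale _ _ fd) faff mulr0.
move=> x v Xx xv; have [s [u [y ->]]] := Xx _ xv.
have [q _ qE] := @param_line d f s 0 u 1 y (fun j => (j == ord0)%:R) fd.
(* Perturb u and y_0 by t: the form vanishes unless u + t or y_0 + t is zero, so [q] is zero, in
   particular at t = 0. *)
have : q * ((u%:P + 'X) * ((y ord0)%:P + 'X)) = 0.
  apply: poly_eq0_of_fun => t; rewrite !hornerM !hornerD !hornerC !hornerX qE mul0r addr0 !mul1r.
  have [->|ut] := eqVneq (u + t) 0; first by rewrite !(mul0r, mulr0).
  have [->|yt] := eqVneq (y ord0 + t) 0; first by rewrite !(mul0r, mulr0).
  by rewrite fgen ?mul0r// eqxx mul1r.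
have XD0 (a : K) : a%:P + 'X != 0.
  by rewrite addrC -size_poly_gt0 size_XaddC.
move/eqP; rewrite mulf_eq0 mulf_eq0 !(negPf (XD0 _)) !orbF => /eqP q0.
have := qE 0; rewrite q0 horner0 !mulr0 !addr0.
by under [X in param _ _ X]funext do rewrite mulr0 addr0.
Qed.

Lemma nodal_variety_variety : projective_variety nodal_variety.
Proof. by split; [exact: nodal_variety_closed|exact: nodal_variety_irreducible]. Qed.

(* The flag of linear subspaces of {node} x P^n, completed by the variety. *)
Lemma nodal_variety_dimension : has_dimension nodal_variety n.+1.
Proof.
split; last by move=> m Z; apply: chain_length_le => d; exact: nodal_hilbert_le.
pose Q i : pred 'I_segreN.+1 := fun k => (rowpos k == row2) && (colpos k <= i)%N.
pose Z i : set P := if (i <= n)%N then coord_subspace (Q i) else nodal_variety.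
have QX i : coord_subspace (Q i) `<=` nodal_variety.
  move=> x h v xv; exists 0, 1, (entry v row2); apply: eq_rowpos => a j.
  rewrite segreE; move: a; apply: ord3P; rewrite /nodal/= ?expr0n/= ?expr1n ?mul0r.
  - by apply: h => //; rewrite /Q mxposK1.
  - by apply: h => //; rewrite /Q mxposK1.
  - by rewrite add0r mul1r.
have QQ i : coord_subspace (Q i) `<=` coord_subspace (Q i.+1).
  by apply: coord_subspace_sub => k /andP[r c]; apply/andP; split=> //; exact: leqW.
exists Z; split=> i.
  rewrite /Z; case: (leqP i n) => _ _; last by split=> //; exact: nodal_variety_variety.
  split; last exact: QX.
  by apply: (@coord_subspace_variety _ _ _ (mxpos row2 ord0)); rewrite /Q mxposK1 mxposK2.
rewrite ltnS => ilen; rewrite /Z ilen.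
have [iltn|nlei] := ltnP i n; (split; first by [exact: QQ|exact: QX]).
  move=> /(_ (ppoint (delta_mx 0 (mxpos row2 (inord i.+1))))).
  rewrite !coord_subspace_delta /Q mxposK1 mxposK2 eqxx/= inordK// ltnn.
  by move=> /(_ (leqnn _)).
(* The last inclusion of the flag is strict at the point s = u = 1, away from the node. *)
have p0 : param 1 1 (fun=> 1) != 0 :> 'rV[K]__.
  by apply/param_neq0; rewrite oner_neq0; split=> //; exists ord0.
move=> /(_ _ (nodal_variety_param p0)).
move=> /(coord_subspace_ppoint _ p0)/(_ (mxpos row0 ord0)).
rewrite segreE /Q mxposK1 /= /nodal/= expr1n !mulr1 => /(_ isT)/eqP.
by rewrite oner_eq0.
Qed.

End Segre.

(** * The action *)

Section Action.
Context (n : nat).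

Definition twist (A : comNzRingType) (t : A) (y : 'I_n.+1 -> A) (j : 'I_n.+1) :=
  t ^+ j * y j.

(* Where two points of the normalization P^1 are glued, no form in the
   coordinates of the curve gives [nodal (t * s) u] itself: it has to be
   multiplied by a form in s, u taking the same value at 0 and infinity after
   multiplication by t^3 s^3 + u^3. The two choices s^3 u^3 and s^3 + t^3 u^3
   have no common zero. *)
Definition chart (A : comNzRingType) (near : bool) (t : A) (c : 'I_3 -> A)
    (i : 'I_3) : A :=
  let a := c row0 in let b := c row1 in let z := c row2 in
  match val i, near with
  | 0, false => t ^+ 2 * (a ^+ 2 * b)
  | 1, false => t * (a * b ^+ 2)
  | _, false => t ^+ 3 * a ^+ 3 + b ^+ 3
  | 0, true => t ^+ 2 * (a * z - b ^+ 2 + t ^+ 3 * b ^+ 2)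
  | 1, true => t * (a ^+ 2 + t ^+ 3 * (b * z - a ^+ 2))
  | _, true => t ^+ 3 * (z ^+ 2 - (a * b) *+ 2) + (a * b + t ^+ 6 * (a * b))
  end.

Definition chart_degree (near : bool) : nat := if near then 2 else 3.

Definition chart_factor (A : comNzRingType) (near : bool) (t s u : A) : A :=
  if near then s ^+ 3 + t ^+ 3 * u ^+ 3 else s ^+ 3 * u ^+ 3.

(** Here [e] stands for the coordinate of P^n that multiplies a column of the Segre matrix. *)
Lemma chart_nodal (A : comNzRingType) near (t s u e : A) i :
  chart near t (fun i => nodal s u i * e) i =
  chart_factor near t s u * e ^+ chart_degree near * nodal (t * s) u i.
Proof.
move: i; apply: ord3P; case: near; rewrite /chart/nodal/chart_factor/=; ring.
Qed.

Lemma chart_rmorph (A B : comNzRingType) (h : {rmorphism A -> B}) near t c i :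
  h (chart near t c i) = chart near (h t) (h \o c) i.
Proof.
move: i; apply: ord3P; case: near; rewrite /chart/=;
  by rewrite !(rmorphD, rmorphN, rmorphMn, rmorphM, rmorphXn)/=.
Qed.

(** Column [k] serves as coordinates on the cubic and row [l] as coordinates on P^n, so the value
    depends on the matrix only, not on parameters. *)
Definition chart_map (A : comNzRingType) near k l (t : A)
    (w : 'I_3 -> 'I_n.+1 -> A) : 'rV[A]_(segreN n).+1 :=
  segre (chart near t (fun i => w i k)) (twist t (w l)).

Lemma chart_map_param (A : comNzRingType) near k l (t s u : A) y :
  chart_map near k l t (fun i j => nodal s u i * y j) =
  (chart_factor near t s u * y k ^+ chart_degree near * nodal s u l) *:
    param (t * s) u (twist t y).
Proof.
apply/rowP => i; rewrite !mxE chart_nodal /twist; ring.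
Qed.

Context (K : numFieldType).
Local Notation N := (segreN n).
Local Notation P := (projspace K N).

Lemma chart_map_exists (t s u : K) y : t != 0 -> param s u y != 0 ->
  exists near k l,
    chart_map near k l t (fun i j => nodal s u i * y j) != 0.
Proof.
move=> t0 /param_neq0[su [k yk]]; have [l cl] := nodal_neq0 su.
(* Off the node s^3 u^3 is nonzero; on the node exactly one of s and u is zero, so s^3 + t^3 u^3 is
   nonzero. *)
exists (s * u == 0), k, l; rewrite chart_map_param scaler_eq0 !mulf_eq0 !negb_or.
rewrite cl andbT expf_neq0// andbT; apply/andP; split.
  rewrite /chart_factor; case: ifPn => [|su0]; last by rewrite -exprMn expf_neq0// mulf_eq0.
  move=> /orP[] /eqP E; move: su; rewrite E eqxx ?orbF/= => z0.
    by rewrite expr0n add0r mulf_neq0// expf_neq0.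
  by rewrite expr0n mulr0 addr0 expf_neq0.
apply/param_neq0; split; last by exists k; rewrite /twist mulf_neq0// expf_neq0.
by rewrite mulf_eq0 negb_or t0.
Qed.

Lemma param_twist_neq0 (t s u : K) y : t != 0 -> param s u y != 0 ->
  param (t * s) u (twist t y) != 0.
Proof.
move=> t0 /(chart_map_exists t0)[near [k [l]]].
by rewrite chart_map_param; apply: contraNneq => ->; rewrite scaler0.
Qed.

Lemma ppoint_chart_map near k l (t s u : K) y :
  let F := chart_map near k l t (fun i j => nodal s u i * y j) in
  F != 0 -> ppoint F = ppoint (param (t * s) u (twist t y)).
Proof.
move=> F; rewrite /F chart_map_param scaler_eq0 negb_or => /andP[c0 p0].
exact: ppoint_scale.
Qed.

(** An arbitrary choice: parameters are determined only up to rescaling, and at the node not even up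
    to the branch. *)
Definition param_of (x : P) : K * K * ('I_n.+1 -> K) :=
  xget (0, 0, fun=> 0) [set p | homogeneous_coords x (param p.1.1 p.1.2 p.2)].

(* t . (c, y) = (t . c, (t^j y_j)_j) on the product of the curve and P^n. *)
Definition act (t : K) (x : P) : P :=
  let: (s, u, y) := param_of x in ppoint (param (t * s) u (twist t y)).

(** Independence of the chosen parameters: two choices give the same matrix up to a scalar, and a
    chart that is nonzero there, being a function of the matrix, computes the result for both. *)
Lemma act_param (t s u : K) y : t != 0 -> param s u y != 0 ->
  act t (ppoint (param s u y)) = ppoint (param (t * s) u (twist t y)).
Proof.
move=> t0 p0; rewrite /act.
have : [set p | homogeneous_coords (ppoint (param s u y)) (param p.1.1 p.1.2 p.2)]
    (param_of (ppoint (param s u y))).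
  rewrite /param_of; case: xgetP => [p ->//|/(_ (s, u, y))/=[]].
  exact: coords_ppoint.
case: (param_of _) => -[s' u'] y' /= xp'.
have [c c0 pE] := coords_uniq (coords_ppoint p0) xp'.
have [near [k [l F0]]] := chart_map_exists t0 p0.
rewrite -(ppoint_chart_map F0).
have wE : (fun i j => nodal s u i * y j) = (fun i j => nodal s' u' i * (c * y' j)).
  apply/funext => i; apply/funext => j.
  by have := congr1 (fun v : 'rV[K]_N.+1 => v 0 (mxpos i j)) pE; rewrite param_scale !segreE.
rewrite wE in F0 *; rewrite ppoint_chart_map//.
have p0' := param_twist_neq0 t0 (coords_neq0 xp').
rewrite -(ppoint_scale c0 p0') param_scale.
by congr (ppoint (param _ _ _)); apply/funext => j; rewrite /twist mulrCA.
Qed.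

Lemma act_one x : nodal_variety x -> act 1 x = x.
Proof.
move=> /nodal_varietyP[s [u [y [p0 -> _]]]]; rewrite (act_param (oner_neq0 K) p0) mul1r.
by congr (ppoint (param _ _ _)); apply/funext => j; rewrite /twist expr1n mul1r.
Qed.

Lemma act_mul (t t' : K) x : t != 0 -> t' != 0 -> nodal_variety x ->
  act (t * t') x = act t (act t' x).
Proof.
move=> t0 t0' /nodal_varietyP[s [u [y [p0 -> _]]]].
rewrite (act_param t0' p0) (act_param (mulf_neq0 t0 t0') p0).
rewrite (act_param t0 (param_twist_neq0 t0' p0)) mulrA.
by congr (ppoint (param _ _ _)); apply/funext => j; rewrite /twist exprMn mulrA.
Qed.

Lemma act_stable (t : K) x : t != 0 -> nodal_variety x -> nodal_variety (act t x).
Proof.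
move=> t0 /nodal_varietyP[s [u [y [p0 -> _]]]]; rewrite (act_param t0 p0).
exact/nodal_variety_param/param_twist_neq0.
Qed.

Definition eval2_morphism (t : K) (v : 'rV[K]_N.+1) :
    {rmorphism mpoly N.+1 {poly K} -> K} :=
  meval (fun i => v 0 i) \o map_mpoly (horner_eval t).

Lemma eval2_time t (v : 'rV[K]_N.+1) : eval2 (mpolyC N.+1 ('X : {poly K})) t v = t.
Proof. by rewrite /eval2/eval map_mpolyC mevalC; exact: hornerX. Qed.

Lemma eval2_coord t (v : 'rV[K]_N.+1) i : eval2 (mpolyX {poly K} (mnm1 i)) t v = v 0 i.
Proof. by rewrite /eval2/eval map_mpolyX mevalXU. Qed.

Definition chart_forms near k l : 'rV[mpoly N.+1 {poly K}]_N.+1 :=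
  chart_map near k l (mpolyC N.+1 ('X : {poly K})) (fun i j => mpolyX _ (mnm1 (mxpos i j))).

Lemma eval2_chart_forms near k l t v :
  \row_i eval2 (chart_forms near k l 0 i) t v = chart_map near k l t (entry v).
Proof.
apply/rowP => i; rewrite !mxE /twist -[LHS]/(eval2_morphism t v _).
rewrite rmorphM rmorphM rmorphXn chart_rmorph.
rewrite [eval2_morphism t v (mpolyC _ _)]eval2_time.
rewrite [eval2_morphism t v (mpolyX _ _)]eval2_coord.
congr (chart _ _ _ _ * _); apply/funext => a /=.
exact: eval2_coord.
Qed.

Lemma homog_map_mpoly (A B : nzRingType) m d (h : {rmorphism A -> B}) (f : mpoly m A) :
  homogeneous_of_degree d f -> homogeneous_of_degree d (map_mpoly h f).
Proof.
move=> /dhomogP fd; apply/dhomogP => i; rewrite mcoeff_msupp mcoeff_map_mpoly => hi.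
by apply: fd; rewrite mcoeff_msupp; apply: contraNneq hi => ->; apply/eqP; exact: rmorph0.
Qed.

Lemma homog_time m d r (f : mpoly m {poly K}) : homogeneous_of_degree d f ->
  homogeneous_of_degree d (mpolyC m ('X : {poly K}) ^+ r * f).
Proof. by move=> fd; rewrite -rmorphXn mul_mpolyC; exact: dhomogZ. Qed.

Lemma homog_chart near (m : nat) (c : 'I_3 -> mpoly m {poly K}) i :
  (forall i, homogeneous_of_degree 1 (c i)) ->
  homogeneous_of_degree (chart_degree near) (chart near (mpolyC m ('X : {poly K})) c i).
Proof.
move=> c1; have cX k i' : homogeneous_of_degree k (c i' ^+ k).
  by have := homogXn k (c1 i'); rewrite mul1n.
have cc a b : homogeneous_of_degree 2 (c a * c b) by exact: (@homogM _ _ 1 1).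
move: i; apply: ord3P; case: near; rewrite /chart/chart_degree/=.
- apply: (homog_time 2); apply: rpredD; last by apply: homog_time; exact: cX.
  by apply: rpredB; [exact: cc|exact: cX].
- by apply: (homog_time 2); apply: (@homogM _ _ 2 1).
- apply: (homog_time 1); apply: rpredD; first exact: cX.
  by apply: homog_time; apply: rpredB; [exact: cc|exact: cX].
- by apply: (homog_time 1); apply: (@homogM _ _ 1 2).
- apply: rpredD; last by apply: rpredD; [exact: cc|exact: homog_time].
  by apply: homog_time; apply: rpredB; [exact: cX|apply: rpredMn; exact: cc].
- by apply: rpredD; [apply: homog_time|]; exact: cX.
Qed.

Lemma homog_chart_forms near k l i :
  homogeneous_of_degree (chart_degree near + 1) (chart_forms near k l 0 i).
Proof.
rewrite mxE; apply: homogM; first by apply: homog_chart => i'; exact: homog_coord.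
by apply: homog_time; exact: homog_coord.
Qed.

Lemma act_regular : regular_on (@nodal_variety n K) act.
Proof.
move=> t0 x0 tn0 /nodal_varietyP[s [u [y [p0 x0E xp]]]].
have [near [k [l F0]]] := chart_map_exists tn0 p0.
pose F i := chart_forms near k l 0 i.
have Fhom i : homogeneous_of_degree (chart_degree near + 1) (F i).
  exact: homog_chart_forms.
have entryE s' u' y' : entry (param s' u' y') = fun i j => nodal s' u' i * y' j :> K.
  by apply/funext => i; apply/funext => j; rewrite /entry segreE.
(* The neighbourhood is the locus where the forms of a chart suited to (t0, x0) do not all
   vanish. *)
exists (~` [set tx | forall f v, range F f -> homogeneous_coords tx.2 v ->
  eval2 f tx.1 v = 0]); split.
- exists (range F); first by move=> _ [i _ <-]; exists (chart_degree near + 1)%N; exact: Fhom.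
  by rewrite setCK.
- move=> /= h; move/eqP: F0; apply; rewrite -entryE -eval2_chart_forms.
  by apply/rowP => i; rewrite mxE [RHS]mxE; apply: h => //; exists i.
exists (chart_degree near + 1)%N, F; split=> // t x v tn Xx Ux xv.
have [s' [u' [y' vE]]] := Xx _ xv.
have xE : x = ppoint v by case/coordsP: xv.
have v0 := coords_neq0 xv.
have Fv0 : \row_i eval2 (F i) t v != 0.
  apply/eqP => Fv; apply: Ux => /= _ w [i _ <-] xw.
  have [c c0 ->] := coords_uniq xw xv.
  move/rowP: Fv => /(_ i); rewrite mxE [RHS]mxE => Fv.
  by rewrite /eval2 (eval_scale _ _ (homog_map_mpoly _ (Fhom i))) [eval _ _]Fv mulr0.
apply/coordsP; split=> //.
rewrite xE vE act_param// -?vE//.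
rewrite eval2_chart_forms vE entryE ppoint_chart_map//.
by rewrite -entryE -vE -eval2_chart_forms.
Qed.

Lemma act_algebraic : algebraic_action (@nodal_variety n K) act.
Proof.
split; [exact: act_stable|exact: act_one| |exact: act_regular].
by move=> s t x s0 t0; exact: act_mul.
Qed.

(* A point fixed by t = 2 lies on the node and has a single nonzero y_j, since
   the weights 2^j are distinct. *)
Lemma act_fixed_points : finite_set (fixed_points (@nodal_variety n K) act).
Proof.
apply: (@sub_finite_set _ _
  (range (fun j => ppoint (delta_mx 0 (mxpos row2 j)) : P))).
  move=> x [/nodal_varietyP[s [u [y [p0 xE _]]]] /(_ 2)].
  have n2 : 2 != 0 :> K by rewrite pnatr_eq0.
  rewrite xE act_param// => /(_ n2).
  move=> /ppoint_eqP[||c c0 pE] //; first exact: param_twist_neq0.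
  have E i j : nodal (2 * s) u i * twist 2 y j = c * (nodal s u i * y j).
    by rewrite -!segreE [LHS](congr1 (fun v : 'rV[K]_N.+1 => v 0 (mxpos i j)) pE) mxE.
  have [su [k yk]] := (param_neq0 s u y).1 p0.
  have cancel a j : y j != 0 -> a * twist 2 y j = c * y j -> a * 2 ^+ j = c.
    by move=> yj; rewrite /twist mulrA => /(mulIf yj).
  (* Off the node, [row0] and [row1] would give 4 2^k = c = 2 2^k. *)
  have su0 : s * u = 0.
    apply: contrapT => /eqP; rewrite mulf_eq0 negb_or => /andP[s0 u0].
    have := E row0 k; have := E row1 k; rewrite /nodal/= => E1 E0.
    have {}E1 : 2 * 2 ^+ k = c.
      apply: (cancel _ k yk); apply: (@mulfI _ (s * u ^+ 2)).
        by rewrite mulf_neq0// expf_neq0.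
      by rewrite [RHS]mulrCA -E1; ring.
    have {}E0 : 4 * 2 ^+ k = c.
      apply: (cancel _ k yk); apply: (@mulfI _ (s ^+ 2 * u)).
        by rewrite mulf_neq0// expf_neq0.
      by rewrite [RHS]mulrCA -E0; ring.
    have : (2 : K) * 2 ^+ k = 0.
      have -> : (2 : K) * 2 ^+ k = 4 * 2 ^+ k - 2 * 2 ^+ k by ring.
      by rewrite E0 E1 subrr.
    by apply/eqP; rewrite mulf_neq0// expf_neq0.
  (* At the node only [row2], that is s^3 + u^3, is left: doubling s multiplies it by 1 if s = 0 and
     by 8 if u = 0. *)
  have [a [a0 aE]] : exists a : K, a != 0 /\ forall j, y j != 0 -> a * 2 ^+ j = c.
    have [s0|s0] := eqVneq s 0.
      exists 1; split; first exact: oner_neq0; move=> j yj.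
      apply: (cancel _ j yj); apply: (@mulfI _ (u ^+ 3)).
        by move: su; rewrite s0 eqxx/= => u0; rewrite expf_neq0.
      have := E row2 j; rewrite /nodal/= s0 mulr0 !expr0n/= !add0r => E2.
      by rewrite mul1r E2; ring.
    have u0 : u = 0 by move/eqP: su0; rewrite mulf_eq0 (negPf s0) => /eqP.
    exists 8; split; first by rewrite pnatr_eq0.
    move=> j yj; apply: (cancel _ j yj); apply: (@mulfI _ (s ^+ 3)).
      by rewrite expf_neq0.
    have := E row2 j; rewrite /nodal/= u0 !expr0n/= !addr0 => E2.
    by rewrite [RHS]mulrCA -E2; ring.
  have yj j : j != k -> y j = 0.
    move=> jk; apply/eqP; apply: contraNT jk => /aE; rewrite -(aE _ yk).
    move=> /(mulfI a0)/eqP; rewrite -!natrX eqr_nat eqn_exp2l//.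
  exists k => //; have yk0 : nodal s u row2 * y k != 0.
    rewrite mulf_neq0// /nodal/=; move/eqP: su0; rewrite mulf_eq0.
    case/orP => /eqP E0; move: su; rewrite E0 eqxx ?orbF/= => z0.
      by rewrite expr0n add0r expf_neq0.
    by rewrite [X in _ + X]expr0n addr0 expf_neq0.
  rewrite -(ppoint_scale yk0) ?delta_neq0//; congr ppoint.
  apply: eq_rowpos => i j; rewrite segreE !mxE eqxx/=.
  have [->|jk] := eqVneq j k; last first.
    rewrite (yj j jk) mulr0; case: eqP => [/(congr1 (@colpos n))|_]; last by rewrite mulr0.
    by rewrite !mxposK2 => jE; rewrite jE eqxx in jk.
  case: eqP => [/(congr1 (@rowpos n))|ne].
    by rewrite !mxposK1 => ->; rewrite mulr1.
  rewrite mulr0; move: i ne; apply: ord3P => // _; rewrite /nodal/=.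
    by rewrite expr2 -[s * s * u]mulrA su0 mulr0 mul0r.
  by rewrite expr2 mulrA su0 !mul0r.
apply: finite_image; exact: finite_finset.
Qed.

End Action.

(** * Winding numbers and the first homology group *)

Lemma int_norm_lt1 (R : realDomainType) (m : int) : `|m%:~R : R| < 1 -> m = 0.
Proof. by rewrite -intr_norm (ltr_int R _ 1); lia. Qed.

(* [q] induces a continuous map to R/Z. *)
Definition continuous_mod1 (R : realType) (Y : topologicalType) (q : Y -> R) :=
  forall y e, 0 < e -> \forall z \near y, exists m : int, `|q z - q y - m%:~R| < e.

Definition lifts (R : realType) (Y : Type) (f q : Y -> R) :=
  forall y, exists m : int, f y - q y = m%:~R.

Lemma continuous_mod1_comp (R : realType) (Y Z : topologicalType) (q : Y -> R)
  (f : Z -> Y) : continuous f -> continuous_mod1 q -> continuous_mod1 (q \o f).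
Proof. by move=> fc qc z e e0; exact: fc (qc (f z) e e0). Qed.

(* The value of the lift of [q] is the representative of [q y] nearest to [g y]. *)
Lemma lift_near (R : realType) (Y : topologicalType) (q g : Y -> R) :
  continuous_mod1 q -> continuous g ->
  (forall y, exists m : int, `|q y - g y - m%:~R| < 4^-1) ->
  exists2 f : Y -> R, continuous f & lifts f q.
Proof.
move=> qc gc /choice[m mE]; exists (fun y => q y - (m y)%:~R); last first.
  by move=> y; exists (- m y); rewrite mulrNz; ring.
move=> y; apply/cvgrPdist_lt => e e0.
have h0 : 0 < Num.min e 8^-1 :> R by rewrite lt_min e0 invr_gt0 ltr0n.
have e8 : 0 < 8^-1 :> R by rewrite invr_gt0 ltr0n.
have := gc y => /cvgrPdist_lt/(_ _ e8); have := qc y _ h0.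
apply: filterS2 => z [k]; rewrite lt_min => /andP[ke k8] gyz.
(* This integer is smaller than 1/4 + 1/4 + 1/8 + 1/8 in absolute value. *)
have n0 : m z - k - m y = 0.
  apply: (@int_norm_lt1 R); rewrite !mulrzBr.
  have := mE y; have := mE z; move: k8 gyz; rewrite !ltr_norml.
  move=> /andP[? ?] /andP[? ?] /andP[? ?] /andP[? ?].
  by apply/andP; split; lra.
have -> : q y - (m y)%:~R - (q z - (m z)%:~R) = - (q z - q y - k%:~R).
  have -> : m z = m y + k by lia.
  by rewrite mulrzDr; ring.
by rewrite normrN.
Qed.

(** * Lifting maps from a simplex to R/Z *)

Section Simplex.
Context (R : realType) (k : nat).
Local Notation S := (std_simplex R k).
Implicit Types (v w : S) (t : R).

Definition bary v i : R := (set_val v : 'rV[R]_k.+1) 0 i.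

Lemma bary_ge0 v i : 0 <= bary v i.
Proof. by have [+ _] := set_mem (valP v); exact. Qed.

Lemma bary_sum v : \sum_i bary v i = 1.
Proof. by have [_] := set_mem (valP v). Qed.

Lemma bary_le1 v i : bary v i <= 1.
Proof.
rewrite -(bary_sum v) (bigD1 i)//= lerDl; apply: sumr_ge0 => j _; exact: bary_ge0.
Qed.

Lemma bary_inj v w : (forall i, bary v i = bary w i) -> v = w.
Proof. by move=> h; apply: val_inj; apply/rowP => i; exact: h. Qed.

Lemma nbhs_simplexP v (U : set S) : nbhs v U <->
  exists2 e : R, 0 < e & forall w, (forall i, `|bary v i - bary w i| < e) -> U w.
Proof.
split=> [|[e e0 eU]].
  rewrite nbhsE => -[W [[B oB <-] Bv] WU].
  have /nbhs_ballP[e /= e0 eB] := open_nbhs_nbhs (conj oB Bv).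
  exists e => // w vw; apply: WU; apply: eB; split=> // i j.
  by rewrite ord1; exact: vw.
have h : nbhs (set_val v : 'rV[R]_k.+1) (ball (set_val v : 'rV[R]_k.+1) e).
  exact: nbhsx_ballx.
move: h; rewrite nbhsE => -[B [oB Bv] Be]; rewrite nbhsE.
exists (set_val @^-1` B); first by split=> //; exists B.
by move=> w /Be[_ vw]; apply: eU => i; exact: vw.
Qed.

(** Keeps [mix t v w] in the simplex for every real [t], so that a segment is a total function of
    [t]. *)
Definition clamp t : R := Num.max 0 (Num.min t 1).

Lemma clamp_ge0 t : 0 <= clamp t.
Proof. by rewrite /clamp le_max lexx. Qed.
Lemma clamp_le1 t : clamp t <= 1.
Proof. by rewrite /clamp ge_max ler01 ge_min lexx orbT. Qed.
Lemma clamp_id t : 0 <= t <= 1 -> clamp t = t.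
Proof. by move=> /andP[t0 t1]; rewrite /clamp min_l// max_r. Qed.
Lemma clamp_dist t t' : `|clamp t - clamp t'| <= `|t - t'|.
Proof.
rewrite /clamp /Num.max /Num.min; rewrite ler_norml.
have := ler_norm (t - t'); have := ler_norm (t' - t); rewrite distrC => h1 h2.
case: (ltP t 1) => ?; case: (ltP t' 1) => ?;
  case: ltP => ?; case: ltP => ?; apply/andP; split; lra.
Qed.

Lemma mix_subproof t v w : simplex_set
  (set_val v + clamp t *: (set_val w - set_val v) : 'rV[R]_k.+1).
Proof.
have t0 := clamp_ge0 t; have t1 := clamp_le1 t.
split=> [i|].
  have v0 := bary_ge0 v i; have w0 := bary_ge0 w i; rewrite !mxE -!/(bary _ i); nra.
under eq_bigr do rewrite !mxE -!/(bary _ _).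
by rewrite big_split/= -mulr_sumr big_split/= sumrN !bary_sum subrr mulr0 addr0.
Qed.

Definition mix t v w : S := SigSub (mem_set (mix_subproof t v w)).

Lemma bary_mix t v w i : bary (mix t v w) i = bary v i + clamp t * (bary w i - bary v i).
Proof. by rewrite [LHS]mxE mxE mxE mxE. Qed.

Lemma mix0 v w : mix 0 v w = v.
Proof. by apply: bary_inj => i; rewrite bary_mix clamp_id ?lexx ?ler01// mul0r addr0. Qed.

Lemma mix1 v w : mix 1 v w = w.
Proof. by apply: bary_inj => i; rewrite bary_mix clamp_id ?lexx ?ler01// mul1r addrC subrK. Qed.

Lemma bary_mix_dist t t' v w i :
  `|bary (mix t v w) i - bary (mix t' v w) i| <= `|t - t'|.
Proof.
rewrite !bary_mix opprD addrACA subrr add0r -mulrBl normrM.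
apply: le_trans (clamp_dist t t'); rewrite ler_piMr//.
have := bary_ge0 v i; have := bary_ge0 w i; have := bary_le1 v i; have := bary_le1 w i.
by move=> *; rewrite ler_norml; apply/andP; split; lra.
Qed.

Lemma mix_continuousl v w : continuous (fun t => mix t v w).
Proof.
move=> t U /nbhs_simplexP[e e0 eU]; apply/nbhs_ballP; exists e => //= t' tt'.
by apply: eU => i; exact: le_lt_trans (bary_mix_dist _ _ _ _ _) tt'.
Qed.

Lemma mix_continuousr t v : continuous (mix t v).
Proof.
move=> w U /nbhs_simplexP[e e0 eU]; apply/nbhs_simplexP; exists e => // w' ww'.
apply: eU => i; apply: le_lt_trans (ww' i).
rewrite !bary_mix (_ : _ - _ = clamp t * (bary w i - bary w' i)); last ring.
by rewrite normrM ler_piMl// ger0_norm ?clamp_ge0 ?clamp_le1.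
Qed.

Lemma simplex_compact : compact (@simplex_set R k).
Proof.
have cube : compact [set v : 'rV[R]_k.+1 | forall i, `[0, 1]%classic (v ord0 i)].
  apply: (@rV_compact R k.+1 (fun=> `[0, 1]%classic)) => i.
  exact: segment_compact.
apply: subclosed_compact cube _; last first.
  move=> v [v0 v1] i; rewrite /= in_itv/= v0/= -v1 (bigD1 i)//= lerDl.
  by apply: sumr_ge0 => j _.
have -> : @simplex_set R k = (\bigcap_i ((fun v : 'rV[R]_k.+1 => v 0 i) @^-1` [set x | 0 <= x]))
    `&` ((fun v : 'rV[R]_k.+1 => \sum_i v 0 i) @^-1` [set x | x = 1]).
  apply/seteqP; split=> v /= [h1 h2]; split=> // i; first by move=> _; exact: h1.
  exact: (h1 i I).
apply: closedI.
  apply: closed_bigI => i _; apply: closed_comp; last exact: closed_ge.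
  by move=> v _; exact: coord_continuous.
apply: closed_comp; last exact: closed_eq.
have sc : continuous (fun v : 'rV[R]_k.+1 => \sum_i v 0 i).
  by apply: continuous_big => [|i _]; [exact: add_continuous|exact: coord_continuous].
by move=> v _; exact: sc.
Qed.

(* Existence of a Lebesgue number. *)
Lemma simplex_uniform_mod1 (q : S -> R) : continuous_mod1 q ->
  exists2 d : R, 0 < d & forall v w, (forall i, `|bary v i - bary w i| < d) ->
    exists m : int, `|q w - q v - m%:~R| < 4^-1.
Proof.
move=> qc.
have := simplex_compact => /compact_near_coveringP/near_covering_withinP.
(* Compactness in near-covering form, with the scale 1 / (M + 1) as parameter: if all small scales
   work near each point, all small scales work everywhere. *)
pose Q (M : nat) (x : 'rV[R]_k.+1) := forall v w, set_val v = x ->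
  (forall i, `|bary v i - bary w i| < M.+1%:R^-1) ->
  exists m : int, `|q w - q v - m%:~R| < 4^-1.
move=> /(_ nat \oo Q _)[x xS|M _ /(_ M (leqnn M))MQ]; last first.
  exists M.+1%:R^-1; first by rewrite invr_gt0 ltr0n.
  by move=> v w; apply: (MQ (set_val v)) => //; exact: (set_mem (valP v)).
pose u : S := SigSub (mem_set xS).
have /nbhs_simplexP[e e0 ue] : \forall z \near u, exists m : int, `|q z - q u - m%:~R| < 8^-1.
  by apply: qc; rewrite invr_gt0 ltr0n.
(* Half of the radius is spent from [u] to [v], half from [v] to [w]; the two bounds 1/8 add up to
   1/4. *)
have e20 : 0 < e / 2 by rewrite divr_gt0.
exists (ball x (e / 2), [set M | M.+1%:R^-1 < e / 2]).
  split; first exact: nbhsx_ballx.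
  exact: (near_infty_natSinv_lt (PosNum e20)).
move=> [x' M] /= [[_ xx'] Me] _ v w vx' vw.
have uv i : `|bary u i - bary v i| < e / 2 by have := xx' 0 i; rewrite -vx'.
have [i|m mE] := ue v; first by apply: lt_trans (uv i) _; lra.
have [i|m' mE'] := ue w.
  rewrite (_ : _ - _ = (bary u i - bary v i) + (bary v i - bary w i)); last ring.
  apply: le_lt_trans (ler_normD _ _) _; rewrite [e]splitr ltrD//.
  exact: lt_trans (vw i) Me.
exists (m' - m); rewrite mulrzBr.
move: mE mE'; rewrite !ltr_norml => /andP[? ?] /andP[? ?].
by apply/andP; split; lra.
Qed.

(** The simplex is expanded from [v0] in J + 1 steps, each shorter than the Lebesgue number. The
    initial lift is constant, and [lift_near] passes from one step to the next. *)
Lemma simplex_lift (q : S -> R) : S -> continuous_mod1 q ->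
  exists2 f : S -> R, continuous f & lifts f q.
Proof.
move=> v0 qc; have [d d0 qd] := simplex_uniform_mod1 qc.
have [J Jd] : exists J : nat, J.+1%:R^-1 < d.
  have [M _ /(_ M (leqnn M))h] := near_infty_natSinv_lt (PosNum d0).
  by exists M.
pose x j w := mix (j%:R / J.+1%:R) v0 w.
suff H j : exists2 f : S -> R, continuous f & lifts f (q \o x j).
  have [f fc fq] := H J.+1; exists f => // w; have [m mE] := fq w.
  by exists m; rewrite -mE /= /x divff ?pnatr_eq0// mix1.
elim: j => [|j [f fc fq]].
  exists (fun=> q v0) => [|w]; first exact: cst_continuous.
  by exists 0; rewrite /= /x mul0r mix0 subrr.
apply: (lift_near (g := f)) => //.
  by apply: continuous_mod1_comp qc; exact: mix_continuousr.
move=> w; have [m mE] := fq w.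
have [i|m' mE'] := qd (x j w) (x j.+1 w).
  apply: le_lt_trans (bary_mix_dist _ _ _ _ _) _.
  rewrite -mulrBl -[j.+1%:R]natr1 opprD addrA subrr sub0r mulN1r normrN.
  by rewrite ger0_norm// invr_ge0 ler0n.
exists (m' - m); rewrite mulrzBr -mE /=.
by rewrite (_ : _ - _ = q (x j.+1 w) - q (x j w) - m'%:~R)//; ring.
Qed.

(** The difference of two lifts is continuous and integer-valued, hence constant along segments. *)
Lemma lift_unique (q f g : S -> R) : continuous f -> continuous g ->
  lifts f q -> lifts g q -> forall v w, f v - f w = g v - g w.
Proof.
move=> fc gc fq gq.
pose h v := f v - g v.
have hc : continuous h by move=> v; exact: (cvgB (fc v) (gc v)).
have hZ v : exists m : int, h v = m%:~R.
  have [m mE] := fq v; have [m' mE'] := gq v.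
  by exists (m - m'); rewrite mulrzBr -mE -mE' /h; ring.
suff H v w : h v = h w.
  by move=> v w; have := H v w; rewrite /h; lra.
wlog : v w / h v <= h w.
  by move=> H; have [/H//|/ltW/H] := leP (h v) (h w).
rewrite le_eqVlt => /orP[/eqP//|vw]; exfalso.
have [m mE] := hZ v; have [m' mE'] := hZ w.
have mm' : m + 1 <= m' by move: vw; rewrite mE mE' ltr_int; lia.
have vw1 : h v + 1 <= h w by rewrite mE mE' -[1]/(1%:~R) -mulrzDr ler_int.
(* Otherwise [h] takes the value [h v] + 1/2 on the segment, which is not an integer. *)
have [||c _ hc2] := @IVT R (fun t => h (mix t v w)) 0 1 (h v + 2^-1) ler01.
- apply: continuous_subspaceT => t.
  exact: (continuous_comp (@mix_continuousl v w t) (hc _)).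
- by rewrite mix0 mix1 ge_min le_max; apply/andP; split; apply/orP; [left|right]; lra.
have [n] := hZ (mix c v w); rewrite hc2 mE => nE.
have : (n - m) = 0.
  by apply: (@int_norm_lt1 R); rewrite mulrzBr -nE ltr_norml; apply/andP; split; lra.
move=> /eqP; rewrite subr_eq0 => /eqP nm; move: nE; rewrite nm => ?; lra.
Qed.

Lemma vertex_subproof (i : 'I_k.+1) : simplex_set (delta_mx 0 i : 'rV[R]_k.+1).
Proof.
split=> [j|]; first by rewrite mxE ler0n.
rewrite (bigD1 i)//= big1 ?mxE ?eqxx ?addr0// => j ji.
by rewrite mxE (negPf ji).
Qed.

Definition vertex i : S := SigSub (mem_set (vertex_subproof i)).

Lemma bary_vertex i j : bary (vertex i) j = (j == i)%:R.
Proof. by rewrite [LHS]mxE eqxx. Qed.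

End Simplex.

Lemma bary_face (R : realType) k i (v : std_simplex R k) j :
  bary (face i v) j = if unlift i j is Some j' then bary v j' else 0.
Proof. by rewrite [LHS]mxE. Qed.

Lemma face_vertex (R : realType) k i j :
  face i (vertex R j) = vertex R (lift i j) :> std_simplex R k.+1.
Proof.
apply: bary_inj => l; rewrite bary_face bary_vertex.
case: unliftP => [l' ->|->]; first by rewrite bary_vertex (inj_eq lift_inj).
by rewrite (negPf (neq_lift _ _)).
Qed.

(** * The winding cocycle *)

Section WindingNumber.
Context (R : realType) (X : topologicalType) (p : X -> R).
Hypothesis pc : continuous_mod1 p.
Local Notation simplex := (singular_simplex R X).

Lemma singular_lift k (s : simplex k) :
  exists f : std_simplex R k -> R, continuous f /\ lifts f (p \o s).
Proof.
have [||f fc fp] := @simplex_lift R k (p \o s); first exact: vertex ord0.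
  by apply: continuous_mod1_comp pc; exact: cts_fun.
by exists f.
Qed.

Definition lift_of k (s : simplex k) := projT1 (cid (singular_lift s)).

(* The variation of p, seen as a function to R/Z, along a path. *)
Definition winding1 (s : simplex 1) : zmodule R :=
  lift_of s (vertex R ord_max) - lift_of s (vertex R ord0).

Lemma winding1E (s : simplex 1) f : continuous f -> lifts f (p \o s) ->
  winding1 s = f (vertex R ord_max) - f (vertex R ord0).
Proof.
move=> fc fs; have [gc gs] := projT2 (cid (singular_lift s)).
exact: lift_unique gc fc gs fs _ _.
Qed.

(** [zmodule R] is R as a module over the integers, the kind of target that linear extension from
    chains takes. *)
Definition winding : chain R X 1 -> zmodule R := fglift winding1.

Lemma winding_is_additive : additive winding.
Proof. exact: lift_is_additive. Qed.

Lemma windingU m (s : simplex 1) : winding (Freeg [:: (m, s)]) = winding1 s *~ m.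
Proof. exact: liftU. Qed.

HB.instance Definition _ :=
  GRing.isZmodMorphism.Build _ _ winding winding_is_additive.

Lemma windingZ (m : int) (c : chain R X 1) : winding (m *: c) = winding c *~ m.
Proof. by rewrite -{1}[m]intz scaler_int raddfMz. Qed.

(** A lift on the 2-simplex restricts to lifts on its three edges, so the alternating sum of
    increments cancels. *)
Lemma winding_simplex_boundary (s : simplex 2) : winding (simplex_boundary s) = 0.
Proof.
have [f [fc fp]] := singular_lift s.
have wE i : winding1 (simplex_face s i) =
    f (vertex R (lift i ord_max)) - f (vertex R (lift i ord0)).
  rewrite -!face_vertex; apply: (winding1E (f := f \o face i)).
    by move=> v; exact: (continuous_comp (@face_continuous R _ i v) (fc _)).
  by move=> v; exact: fp.
pose y (j : 'I_3) := f (vertex R j).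
have yE (i : 'I_3) a b : lift i ord_max = a -> lift i ord0 = b ->
    winding1 (simplex_face s i) = y a - y b by move=> <- <-; exact: wE.
rewrite raddf_sum/= !big_ord_recl big_ord0 !windingZ !windingU !mulr1z.
have -> := yE ord0 row2 row1; try exact: ord_inj.
have -> := yE (lift ord0 ord0) row2 row0; try exact: ord_inj.
have -> := yE (lift ord0 (lift ord0 ord0)) row1 row0; try exact: ord_inj.
rewrite /= /bump/= mulrN1z.
have E (a b c : R) : a - b + (- (a - c) + (b - c + 0)) = 0 by ring.
exact: E.
Qed.

Lemma winding_boundary (c : chain R X 2) : winding (boundary c) = 0.
Proof.
pose b : {additive chain R X 2 -> chain R X 1} :=
  HB.pack (@boundary R X 1) (GRing.isZmodMorphism.Build _ _ _ (@boundary_additive R X 1)).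
rewrite -(freeg_sumE c) -[boundary _]/(b _) !raddf_sum big1// => s _.
by rewrite /b/= /boundary liftU windingZ winding_simplex_boundary mul0rz.
Qed.

End WindingNumber.

Definition homology_class (R : realType) (X : topologicalType) k (z : cycle R X k) :
  homology R X k := \pi_(homology R X k) z.

(** If m times the class of the loop is zero, the cocycle property makes m times the increment of
    [f] zero, so m = 0: this one class is independent over the integers. *)
Lemma betti1_neq0 (R : realType) (X : topologicalType) (p : X -> R)
    (s : singular_simplex R X 1) (f : std_simplex R 1 -> R) :
  continuous_mod1 p -> simplex_face s ord0 = simplex_face s ord_max ->
  continuous f -> lifts f (p \o s) -> f (vertex R ord0) <> f (vertex R ord_max) ->
  betti R 1 X != 0%E.
Proof.
move=> pc sclosed fc fp fne.
have scycle : is_cycle (Freeg [:: (1, s)] : chain R X 1).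
  rewrite /is_cycle/= /boundary liftU scale1r /simplex_boundary.
  rewrite !big_ord_recl big_ord0 expr0 expr1 scale1r scaleN1r addr0.
  rewrite (_ : lift ord0 ord0 = ord_max) ?sclosed ?subrr//; exact: ord_inj.
pose z : cycle R X 1 := exist (fun c : chain R X 1 => is_cycle c) _ scycle.
have z_free (m : int) : homology_class z *~ m = 0 -> m = 0.
  rewrite /homology_class -raddfMz -[RHS](raddf0 \pi_(homology R X 1)) => /eqP.
  rewrite -Quotient.idealrBE subr0 => /asboolP[c cE].
  have vE : val (z *~ m) = val z *~ m by exact: (raddfMz val).
  have := winding_boundary pc c; rewrite cE vE raddfMz.
  rewrite [X in X *~ _](etrans (windingU pc 1 s) (mulr1z _)).
  rewrite (winding1E pc fc fp) => /eqP.
  rewrite -[_ *~ m]/((f _ - f _ : R) *~ m) mulrz_eq0 => /orP[/eqP//|].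
  by rewrite subr_eq0 eq_sym => /eqP/fne.
have : (1 <= betti R 1 X)%E.
  apply: ereal_sup_ubound; exists 1%N => //; exists (fun=> homology_class z) => m.
  by rewrite big_ord1 => /z_free m0 i; rewrite ord1.
by apply: contraTneq => ->; rewrite -ltNge lte01.
Qed.

(** * A loop of winding number one *)

Local Open Scope complex_scope.

(** * The complex modulus *)

Section ComplexModulus.
Context (R : realType).
Implicit Types z w : R[i].

(** The norm of [R[i]] takes values in [R[i]] itself; this is the same number in [R]. *)
Definition modulus z : R := complex.Re `|z|.

Lemma modulusE z : `|z| = (modulus z)%:C.
Proof. by rewrite /modulus normc_def. Qed.

Lemma modulus_ge0 z : 0 <= modulus z.
Proof. by rewrite -lecR -modulusE; exact: normr_ge0. Qed.

Lemma modulusM z w : modulus (z * w) = modulus z * modulus w.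
Proof. by apply: (@complexI R); rewrite rmorphM/= -!modulusE normrM. Qed.

Lemma modulusX z k : modulus (z ^+ k) = modulus z ^+ k.
Proof. by apply: (@complexI R); rewrite rmorphXn/= -!modulusE normrX. Qed.

Lemma modulus_eq0 z : (modulus z == 0) = (z == 0).
Proof. by rewrite -(inj_eq (@complexI R)) -modulusE rmorph0 normr_eq0. Qed.

Lemma modulus0 : modulus 0 = 0.
Proof. by apply/eqP; rewrite modulus_eq0. Qed.

Lemma modulusD z w : modulus (z + w) <= modulus z + modulus w.
Proof. by rewrite -lecR rmorphD/= -!modulusE ler_normD. Qed.

Lemma modulus_real (a : R) : 0 <= a -> modulus a%:C = a.
Proof. by move=> a0; apply: (@complexI R); rewrite -modulusE ger0_norm ?ler0c. Qed.

Local Notation C := ((R[i] : numFieldType) : Type).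

Lemma modulus_continuous : continuous (modulus : C -> R).
Proof.
move=> z U /nbhs_ballP[e e0 eU]; apply/nbhs_ballP; exists e%:C.
  by rewrite /= ltcR.
move=> w /= zw; apply: eU; move: zw; rewrite /ball/= modulusE ltcR; apply: le_lt_trans.
rewrite ler_norml; have := modulusD w (z - w); have := modulusD z (w - z).
have -> : modulus (w - z) = modulus (z - w).
  by apply: (@complexI R); rewrite -!modulusE distrC.
by rewrite !subrKC => *; apply/andP; split; lra.
Qed.

Lemma real_complex_continuous : continuous ((fun a : R => a%:C) : R -> C).
Proof.
move=> a U /nbhs_ballP[e /= e0 eU].
(* Radii of balls in [R[i]] are complex numbers, and a positive one is real. *)
have eE : e = (complex.Re e)%:C.
  by case: (e) e0 => x y; rewrite ltcE/= => /andP[/eqP->].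
move: e0 eU; rewrite eE ltcR; set d := complex.Re e => d0 eU.
apply/nbhs_ballP; exists d => // b ab; apply: eU => /=.
by rewrite /ball/= -rmorphB modulusE /modulus normc_def/= expr0n/= addr0 sqrtr_sqr ltcR.
Qed.

End ComplexModulus.

(** * Topology of projective space *)

Section Topology.
Context (K : numFieldType) (N : nat) (R : realType).

Lemma continuous_rV (T : topologicalType) (g : T -> 'rV[K]_N.+1) :
  (forall k, continuous (fun x => g x 0 k)) -> continuous g.
Proof.
move=> gc x A [P gP PA].
have : \forall y \near x, forall k, P 0 k (g y 0 k).
  by apply: filter_forall => k; exact: gc k x _ (gP 0 k).
by apply: filterS => y Py; apply: PA => i k; rewrite ord1; exact: Py.
Qed.

Lemma open_projspace (W : set (projspace K N)) : open W ->
  exists2 V : set 'rV[K]_N.+1, open V & forall v, v != 0 -> W (ppoint v) <-> V v.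
Proof.
move=> [V oV VW]; exists V => // v v0.
have := congr1 (fun A : set (nonzero_vec K N) => A (nonzero_of v)) VW => /=.
by rewrite set_val_nonzero_of// => ->.
Qed.

Lemma ppoint_continuous (T : topologicalType) (g : T -> 'rV[K]_N.+1) :
  continuous g -> (forall x, g x != 0) -> continuous (fun x => ppoint (g x)).
Proof.
move=> gc g0; apply/continuousP => W /open_projspace[V oV WV].
suff -> : (fun x => ppoint (g x)) @^-1` W = g @^-1` V by move/continuousP: gc; exact.
by apply/seteqP; split=> x /=; rewrite WV.
Qed.

(** Supplies neighbourhoods for the continuity of the angle: a sign condition stable under scaling
    descends to the quotient. *)
Lemma open_positive (g : 'rV[K]_N.+1 -> R) : continuous g ->
  (forall c v, c != 0 -> 0 < g v -> 0 < g (c *: v)) ->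
  open [set x : projspace K N | forall v, homogeneous_coords x v -> 0 < g v].
Proof.
move=> gc gZ; exists [set v | 0 < g v].
  have := continuousP g => -[+ _] => /(_ gc [set a | 0 < a]); apply; exact: open_gt.
apply/seteqP; split=> u /=.
  move=> gu v uv; have [c c0 ->] := coords_uniq uv (ex_intro2 _ _ u erefl erefl).
  exact: gZ.
by apply; exists u.
Qed.

Lemma continuous_set_type (T U : topologicalType) (A : set U) (f : T -> A) :
  continuous (set_val \o f) -> continuous f.
Proof.
move=> fc; apply/continuousP => _ [W oW <-].
by move/continuousP: fc => /(_ W oW).
Qed.

End Topology.

(** * The map from the variety to R/Z *)

Section Angle.
Context (R : realType) (n : nat).
Local Notation C := (R[i] : numFieldType).
Local Notation N := (segreN n).
Local Notation X := (@nodal_variety n C).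
Implicit Types (v : 'rV[C]_N.+1) (x : projspace C N).

(** Summing over a row splits off the P^n factor: at a parametrized point all rows share the sum of
    the |y_j|, which cancels in ratios. *)
Definition row_modulus v i : R := \sum_j modulus (entry v i j).

Lemma row_modulus_ge0 v i : 0 <= row_modulus v i.
Proof. by apply: sumr_ge0 => j _; exact: modulus_ge0. Qed.

Lemma row_modulus_scale (c : C) v i : row_modulus (c *: v) i = modulus c * row_modulus v i.
Proof.
by rewrite mulr_sumr; apply: eq_bigr => j _; rewrite /entry mxE modulusM.
Qed.

Lemma row_modulus_param (s u : C) y i :
  row_modulus (param s u y) i = modulus (nodal s u i) * \sum_j modulus (y j).
Proof.
by rewrite mulr_sumr; apply: eq_bigr => j _; rewrite /entry segreE modulusM.
Qed.

Lemma row_modulus_continuous i : continuous (row_modulus ^~ i).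
Proof.
apply: continuous_big => [|j _]; first exact: add_continuous.
move=> v; exact: (continuous_comp (@coord_continuous C 1 N.+1 0 _ v) (@modulus_continuous R _)).
Qed.

Lemma sum_modulus_gt0 (y : 'I_n.+1 -> R[i]) k : y k != 0 -> 0 < \sum_j modulus (y j).
Proof.
move=> yk; rewrite (bigD1 k)//=; apply: ltr_pwDl.
  by rewrite lt_def modulus_eq0 yk modulus_ge0.
by apply: sumr_ge0 => *; exact: modulus_ge0.
Qed.

(** Used with a = |s|, b = |u|, c = |s^3 + u^3|. Near the node |X| + |Y| is small compared with |Z|,
    which makes a b small compared with a^2 + b^2, so a / b or b / a is small. *)
Lemma ratio_near_integer (a b c e : R) : 0 < a -> 0 < b -> 0 < e ->
  0 < e / 2 * c - (a ^+ 2 * b + a * b ^+ 2) -> c <= a ^+ 3 + b ^+ 3 ->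
  exists m : int, `|a / (a + b) - m%:~R| < e.
Proof.
move=> a0 b0 e0 h1 h2; have ab : 0 < a + b by lra.
have h : a * b < e / 2 * (a ^+ 2 + b ^+ 2).
  rewrite -(ltr_pM2r ab).
  have -> : a * b * (a + b) = a ^+ 2 * b + a * b ^+ 2 by ring.
  rewrite subr_gt0 in h1; apply: lt_le_trans h1 _; rewrite -[leRHS]mulrA ler_pM2l; last lra.
  apply: le_trans h2 _; rewrite -subr_ge0.
  have -> : (a ^+ 2 + b ^+ 2) * (a + b) - (a ^+ 3 + b ^+ 3) = a * b * (a + b) by ring.
  by rewrite !mulr_ge0// ltW.
have [le_ab|/ltW le_ba] := leP a b.
  exists 0; rewrite subr0 ger0_norm; last by rewrite divr_ge0// ltW.
  rewrite ltr_pdivrMr//; have : a * b < e * (b * b).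
    have h3 : a ^+ 2 <= b ^+ 2 by apply: lerXn2r => //; rewrite nnegrE; exact: ltW.
    have : 0 <= e * (b ^+ 2 - a ^+ 2) by rewrite mulr_ge0 ?subr_ge0// ltW.
    by move: h; rewrite !expr2; lra.
  by rewrite mulrA ltr_pM2r// => ?; nra.
exists 1; have -> : a / (a + b) - 1%:~R = - (b / (a + b)) by field; exact: lt0r_neq0.
rewrite normrN ger0_norm; last by rewrite divr_ge0// ltW.
rewrite ltr_pdivrMr//; have : b * a < e * (a * a).
  have h3 : b ^+ 2 <= a ^+ 2 by apply: lerXn2r => //; rewrite nnegrE; exact: ltW.
  have : 0 <= e * (a ^+ 2 - b ^+ 2) by rewrite mulr_ge0 ?subr_ge0// ltW.
  by move: h; rewrite !expr2; lra.
by rewrite mulrA ltr_pM2r// => ?; nra.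
Qed.

(* The coordinate |s| / (|s| + |u|) of the normalization, where 0 and infinity
   are glued to the node; division by 0 gives the value 0 on the node. *)
Definition angle x : R :=
  let v := xget 0 [set v | homogeneous_coords x v] in
  row_modulus v row0 / (row_modulus v row0 + row_modulus v row1).

Lemma angleE x v : homogeneous_coords x v ->
  angle x = row_modulus v row0 / (row_modulus v row0 + row_modulus v row1).
Proof.
move=> xv; rewrite /angle; case: xgetP => [w _ /= xw|/(_ v)//].
have [c c0 ->] := coords_uniq xw xv.
rewrite !row_modulus_scale -mulrDr -mulf_div divff ?mul1r//.
by rewrite modulus_eq0.
Qed.

Lemma angle_param (s u : C) y : param s u y != 0 -> s * u != 0 ->
  angle (ppoint (param s u y)) = modulus s / (modulus s + modulus u).
Proof.
move=> p0 su0; rewrite (angleE (coords_ppoint p0)) !row_modulus_param.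
rewrite /nodal/= !modulusM ?modulusX.
have [_ [k yk]] := (param_neq0 s u y).1 p0.
have Y0 := sum_modulus_gt0 yk.
move: su0; rewrite mulf_eq0 negb_or -!modulus_eq0 => /andP[s0 u0].
have sp : 0 < modulus s by rewrite lt_def s0 modulus_ge0.
have up : 0 < modulus u by rewrite lt_def u0 modulus_ge0.
move: sp up Y0; clear; move: (modulus s) (modulus u) (\sum_j _) => a b Y a0 b0 Y0.
have -> : a ^+ 2 * b * Y + a * b ^+ 2 * Y = a * b * Y * (a + b) by ring.
have -> : a ^+ 2 * b * Y = a * b * Y * a by ring.
by rewrite -mulf_div divff ?mul1r// !mulf_neq0// lt0r_neq0.
Qed.

Lemma angle_node (s u : C) y : param s u y != 0 -> s * u = 0 ->
  angle (ppoint (param s u y)) = 0.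
Proof.
move=> p0 su0; rewrite (angleE (coords_ppoint p0)) !row_modulus_param.
rewrite {1}/nodal/= (_ : s ^+ 2 * u = 0) ?modulus0 ?mul0r//.
by rewrite expr2 -mulrA su0 mulr0.
Qed.

Lemma angle_continuous_mod1 :
  continuous_mod1 (fun x : set_type X => angle (set_val x)).
Proof.
move=> x0 e e0.
suff [W [oW Wx0 We]] : exists W : set (projspace C N), [/\ open W, W (set_val x0) &
    forall x, X x -> W x -> exists m : int, `|angle x - angle (set_val x0) - m%:~R| < e].
  have : nbhs x0 (set_val @^-1` W).
    by apply: open_nbhs_nbhs; split=> //; exists W.
  by apply: filterS => x Wx; apply: We => //; exact: (set_mem (valP x)).
have := set_mem (valP x0); rewrite -[val x0]/(set_val x0).
move: (set_val x0) => {}x0 Xx0; have [v xv] := coords_exists x0.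
pose A v := row_modulus v row0; pose B v := row_modulus v row1.
pose Z v := row_modulus v row2.
have Ac : continuous A by exact: row_modulus_continuous.
have Bc : continuous B by exact: row_modulus_continuous.
have Zc : continuous Z by exact: row_modulus_continuous.
have A0 w : 0 <= A w by exact: row_modulus_ge0.
have B0 w : 0 <= B w by exact: row_modulus_ge0.
have pos (g : 'rV[C]_N.+1 -> R) : continuous g ->
    (forall c w, g (c *: w) = modulus c * g w) -> 0 < g v ->
    open [set x : projspace C N | forall w, homogeneous_coords x w -> 0 < g w] /\
    (forall w, homogeneous_coords x0 w -> 0 < g w).
  move=> gc gZ gv; split; last first.
    move=> w xw; have [c c0 ->] := coords_uniq xw xv; rewrite gZ mulr_gt0//.
    by rewrite lt_def modulus_eq0 c0 modulus_ge0.
  apply: open_positive gc _ => c w c0 gw; rewrite gZ mulr_gt0//.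
  by rewrite lt_def modulus_eq0 c0 modulus_ge0.
(* At the node, the neighbourhood is A + B < (e / 2) Z, where the angle is close to 0 or 1. *)
have [AB0|AB0] := eqVneq (A v + B v) 0.
  have a0 : angle x0 = 0 by rewrite (angleE xv) AB0 invr0 mulr0.
  have [Av Bv] : A v = 0 /\ B v = 0.
    by split; apply/eqP; rewrite eq_le ?A0 ?B0 andbT; have := A0 v; have := B0 v; lra.
  have row_eq0 i : row_modulus v i = 0 -> forall j, entry v i j = 0.
    move=> /eqP; rewrite psumr_eq0 => [/allP h j|j _]; last exact: modulus_ge0.
    by apply/eqP; rewrite -modulus_eq0; exact: h (mem_index_enum j).
  have Zv : 0 < Z v.
    rewrite lt_def row_modulus_ge0 andbT; apply/eqP => Zv0.
    have /eqP[] := coords_neq0 xv; apply: eq_rowpos => i j; rewrite [RHS]mxE.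
    by move: i; apply: ord3P; exact: row_eq0.
  have gc : continuous (fun w => e / 2 * Z w - (A w + B w)).
    move=> w; exact: (cvgB (cvgM (cvg_cst _) (Zc w)) (cvgD (Ac w) (Bc w))).
  have [||oW Wx0] := pos _ gc.
  - by move=> c w; rewrite /A/B/Z !row_modulus_scale; ring.
  - by rewrite AB0 subr0 mulr_gt0// divr_gt0.
  exists [set x : projspace C N | forall w, homogeneous_coords x w ->
      0 < e / 2 * Z w - (A w + B w)]; split=> //.
  move=> x /nodal_varietyP[s [u [y [p0 -> xp]]]] /(_ _ (coords_ppoint p0)).
  rewrite a0 subr0.
  have [su0|su0] := eqVneq (s * u) 0.
    by exists 0; rewrite angle_node// subr0 normr0.
  move: su0 => /[dup] su0; rewrite mulf_eq0 negb_or -!modulus_eq0 => /andP[s0 u0].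
  rewrite angle_param// /A/B/Z !row_modulus_param /nodal/= => h.
  have [_ [k yk]] := (param_neq0 s u y).1 p0.
  have := modulusD (s ^+ 3) (u ^+ 3); move: h.
  rewrite -[X in _ - X]mulrDl [X in X - _]mulrA -mulrBl pmulr_lgt0; last exact: sum_modulus_gt0 yk.
  rewrite [modulus (s ^+ 2 * u)]modulusM [modulus (s * u ^+ 2)]modulusM !modulusX.
  have sp : 0 < modulus s by rewrite lt_def s0 modulus_ge0.
  have up : 0 < modulus u by rewrite lt_def u0 modulus_ge0.
  by move=> *; apply: ratio_near_integer; eassumption.
(* Off the node the angle itself is continuous. The bound on its variation is multiplied by A + B to
   become homogeneous, and in this form it also excludes A + B = 0. *)
have gc : continuous (fun w => e * (A w + B w) - `|A w - angle x0 * (A w + B w)|).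
  have ABc a : continuous (fun w => a * (A w + B w)).
    by move=> w; exact: (cvgM (cvg_cst a) (cvgD (Ac w) (Bc w))).
  have dc : continuous (fun w => A w - angle x0 * (A w + B w)).
    by move=> w; exact: (cvgB (Ac w) (ABc _ w)).
  by move=> w; exact: (cvgB (ABc e w) (cvg_norm (dc w))).
have ABv : 0 < A v + B v by rewrite lt_def AB0 addr_ge0.
have [||oW Wx0] := pos _ gc.
- move=> c w; rewrite /A/B/Z !row_modulus_scale -!mulrDr.
  rewrite [angle x0 * _]mulrCA -mulrBr normrM (ger0_norm (modulus_ge0 c)); ring.
- rewrite (angleE xv) -mulrA mulVf// mulr1 subrr normr0 subr0 mulr_gt0//.
exists [set x : projspace C N | forall w, homogeneous_coords x w ->
  0 < e * (A w + B w) - `|A w - angle x0 * (A w + B w)|]; split=> //.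
move=> x Xx Wx; have [w xw] := coords_exists x; have := Wx w xw; rewrite subr_gt0.
have [->|ABw] := eqVneq (A w + B w) 0; first by rewrite !mulr0 ltNge normr_ge0.
have {}ABw : 0 < A w + B w by rewrite lt_def ABw addr_ge0.
move=> h; exists 0; rewrite subr0 (angleE xw) -/(A w) -/(B w).
rewrite -(ltr_pM2r ABw); apply: le_lt_trans h.
rewrite -[X in `|_| * X](ger0_norm (ltW ABw)) -normrM mulrBl divfK//.
by rewrite lt0r_neq0.
Qed.

End Angle.

(** * The loop through the node *)

Section Loop.
Context (R : realType) (n : nat).
Local Notation C := (R[i] : numFieldType).
Local Notation N := (segreN n).
Local Notation X := (@nodal_variety n C).
Implicit Types v : std_simplex R 1.

Lemma bary_continuous k i : continuous (fun v : std_simplex R k => bary v i).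
Proof.
move=> v U /nbhs_ballP[e e0 eU]; apply/nbhs_simplexP; exists e => // w vw.
by apply: eU; exact: vw.
Qed.

Definition loop_coords v : 'rV[C]_N.+1 :=
  param (bary v ord_max)%:C (bary v ord0)%:C (fun j => (j == ord0)%:R).

Lemma bary1_sum v : bary v ord0 + bary v ord_max = 1.
Proof.
rewrite -(bary_sum v) !big_ord_recl big_ord0 addr0.
by congr (_ + bary v _); exact: ord_inj.
Qed.

Lemma loop_coords_neq0 v : loop_coords v != 0.
Proof.
apply/param_neq0; split; last by exists ord0; rewrite eqxx oner_neq0.
rewrite -negb_and -!(rmorph0 (real_complex R)) !(inj_eq (@complexI R)).
apply/negP => /andP[/eqP v1 /eqP v0]; have := bary1_sum v.
by rewrite v0 v1 addr0 => /eqP; rewrite eq_sym oner_eq0.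
Qed.

Lemma loop_coords_continuous : continuous loop_coords.
Proof.
apply: continuous_rV => k.
(* The coordinates are real numbers: continuity is proved in R and carried to C by the embedding. *)
pose h v := nodal (bary v ord_max) (bary v ord0) (rowpos k) * (colpos k == ord0)%:R.
have hE v : loop_coords v 0 k = (h v)%:C.
  rewrite mxE /h rmorphM/= rmorph_nat; congr (_ * _).
  by move: (rowpos k); apply: ord3P; rewrite /nodal/= !(rmorphD, rmorphM, rmorphXn).
rewrite (_ : (fun v => _) = (fun v => (h v)%:C)); last exact/funext.
suff nc : continuous (fun v => nodal (bary v ord_max) (bary v ord0) (rowpos k)).
  have hc : continuous h.
    by move=> v; apply: (cvgM (nc v)); exact: cvg_cst.
  by move=> v; exact: (continuous_comp (hc v) (@real_complex_continuous R _)).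
move: (rowpos k) => {h hE} i v.
have b0 := @bary_continuous 1 ord0 v; have b1 := @bary_continuous 1 ord_max v.
move: i; apply: ord3P; rewrite /nodal/=.
- exact: (cvgM (cvgM b1 b1) b0).
- exact: (cvgM b1 (cvgM b0 b0)).
- exact: (cvgD (cvgM b1 (cvgM b1 b1)) (cvgM b0 (cvgM b0 b0))).
Qed.

Definition loop_fun v : X :=
  SigSub (mem_set (nodal_variety_param (loop_coords_neq0 v))).

Lemma loop_continuous : continuous loop_fun.
Proof.
apply: continuous_set_type.
exact: ppoint_continuous loop_coords_continuous loop_coords_neq0.
Qed.

Definition loop : singular_simplex R X 1 := mkcts loop_continuous.

(** The ends have (s, u) = (1, 0) and (0, 1), the two preimages of the node. *)
Lemma loop_closed : simplex_face loop ord0 = simplex_face loop ord_max.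
Proof.
apply/continuousEP => v; apply: val_inj.
suff E : loop_coords (face ord0 v) = loop_coords (face ord_max v).
  exact: (congr1 (@ppoint C N) E).
have v1 : bary v ord0 = 1 by have := bary_sum v; rewrite big_ord1.
have f0 : bary (face ord0 v) ord0 = 0 by rewrite bary_face unlift_none.
have fm : bary (face ord_max v) ord_max = 0 by rewrite bary_face unlift_none.
have := bary1_sum (face ord0 v); rewrite f0 add0r => f1.
have := bary1_sum (face ord_max v); rewrite fm addr0 => fm0.
apply: eq_rowpos => i j; rewrite !segreE f0 f1 fm fm0 rmorph0 rmorph1; congr (_ * _).
by move: i; apply: ord3P; rewrite /nodal/= !expr0n !expr1n ?mulr0 ?mul0r// addrC.
Qed.

(** As |s| + |u| = 1 along the loop, the angle equals s, except at the end s = 1, where the angle is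
    0 and the difference is the integer 1. *)
Lemma loop_lift :
  lifts (fun v => bary v ord_max) ((fun x : X => angle (set_val x)) \o loop).
Proof.
move=> v; have p0 := loop_coords_neq0 v.
rewrite /= -[set_val _]/(ppoint (loop_coords v)).
have vs := bary1_sum v.
have [su0|su0] := eqVneq ((bary v ord_max)%:C * (bary v ord0)%:C) 0.
  rewrite angle_node// subr0.
  have : bary v ord_max * bary v ord0 = 0 by apply: (@complexI R); rewrite rmorphM rmorph0.
  move=> /eqP; rewrite mulf_eq0 => /orP[/eqP ->|/eqP v0]; first by exists 0.
  by exists 1; move: vs; rewrite v0 add0r.
by exists 0; rewrite angle_param// !modulus_real ?bary_ge0// [X in _ / X]addrC vs divr1 subrr.
Qed.

Lemma betti1_nodal_variety : betti R 1 (set_type X) != 0%E.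
Proof.
apply: (betti1_neq0 (@angle_continuous_mod1 R n) loop_closed _ loop_lift).
  exact: bary_continuous.
by rewrite !bary_vertex eqxx /= => /eqP; rewrite eq_sym oner_eq0.
Qed.

End Loop.

Theorem mainTheorem2 (R : realType) (n : nat) (hn : (1 <= n)%N) :
  exists (N : nat) (X : set (projspace R[i] N)),
    [/\ projective_variety X,
        has_dimension X n,
        (exists a : R[i] -> projspace R[i] N -> projspace R[i] N,
           algebraic_action X a /\ finite_set (fixed_points X a)) &
        betti R 1 (set_type X) != 0%E].
Proof.
(* The product of the cubic and P^n has dimension n + 1, hence the shift by one. *)
case: n hn => [//|n] _; exists (segreN n), (@nodal_variety n R[i]); split.
- exact: nodal_variety_variety.
- exact: nodal_variety_dimension.
- by exists (@act n R[i]); split; [exact: act_algebraic|exact: act_fixed_points].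
- exact: betti1_nodal_variety.
Qed.
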